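(* Let $K$ be a field of characteristic $0$ and let $\mathbf{FQSym}$ be the Malvenuto–Reutenauer Hopf algebra of free quasi-symmetric functions over $K$. Then the Lie algebra $Prim(\mathbf{FQSym})=\{x\in\mathbf{FQSym}:\Delta(x)=x\otimes1+1\otimes x\}$ of its primitive elements (with bracket the commutator) is a free Lie algebra.
   Context: $\mathbf{FQSym}$ is the $K$-vector space with basis $(\mathbf F_u)$, $u\in\bigsqcup_{n\ge0}S_n$; permutations are written as words $u=(u_1\ldots u_n)$. Product: for $u\in S_n$, $v\in S_m$, $\mathbf F_u\mathbf F_v=\sum_{\zeta\in sh(n,m)}\mathbf F_{(u\times v).\zeta^{-1}}$, i.e. the sum of $\mathbf F_w$ over all shuffles $w$ of the words $u_1\ldots u_n$ and $(v_1+n)\ldots(v_m+n)$. Coproduct: $\Delta(\mathbf F_u)=\sum_{i=0}^n\mathbf F_{st(u_1\ldots u_i)}\otimes\mathbf F_{st(u_{i+1}\ldots u_n)}$, where $st$ denotes standardization of a word with distinct letters. The unit is $1=\mathbf F_\emptyset$, $\emptyset$ being the unique element of $S_0$. *)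

(* Defs.v *)
From HB Require Import structures.
From mathcomp Require Import all_boot all_fingroup all_algebra.
From mathcomp Require Import finmap zify.
From mathcomp.multinomials Require Import monalg.

Set Implicit Arguments.
Unset Strict Implicit.
Unset Printing Implicit Defensive.

Import GRing.Theory.

Local Open Scope ring_scope.

HB.mixin Record Lmodule_isLie (K : pzRingType) V of GRing.Lmodule K V := {
  bracket : V -> V -> V;
  bracketPl : forall (a : K) (x y z : V),
    bracket (a *: x + y) z = a *: bracket x z + bracket y z;
  bracketPr : forall (a : K) (x y z : V),
    bracket z (a *: x + y) = a *: bracket z x + bracket z y;
  bracketxx : forall x : V, bracket x x = 0;
  jacobi : forall x y z : V,
    bracket x (bracket y z) + bracket y (bracket z x)
      + bracket z (bracket x y) = 0
}.

#[short(type="lieAlgType")]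
HB.structure Definition LieAlgebra (K : pzRingType) :=
  {V of Lmodule_isLie K V & GRing.Lmodule K V}.

Definition lie_morphism (K : pzRingType) (g h : lieAlgType K) (phi : g -> h)
  : Prop :=
  linear phi /\ forall x y, phi (bracket x y) = bracket (phi x) (phi y).

(* universal property: every map from X to a Lie algebra over K extends uniquely
   along i to a morphism of Lie algebras *)
Definition free_lie_on (K : pzRingType) (g : lieAlgType K)
    (X : Type) (i : X -> g) : Prop :=
  forall (h : lieAlgType K) (f : X -> h),
    (exists phi : g -> h, lie_morphism phi /\ forall x, phi (i x) = f x)
    /\ (forall phi psi : g -> h, lie_morphism phi -> lie_morphism psi ->
          (forall x, phi (i x) = f x) -> (forall x, psi (i x) = f x) ->
          forall y, phi y = psi y).

Definition is_free_lie (K : pzRingType) (g : lieAlgType K) : Prop :=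
  exists (X : Type) (i : X -> g), free_lie_on i.

Lemma commutator_jacobi (R : pzRingType) (x y z : R) :
  (x * (y * z - z * y) - (y * z - z * y) * x)
  + (y * (z * x - x * z) - (z * x - x * z) * y)
  + (z * (x * y - y * x) - (x * y - y * x) * z) = 0.
Proof.
rewrite !(mulrBl, mulrBr) !mulrA !opprB.
rewrite [LHS](AC (((2*2)*(2*2))*(2*2)) ((1*12)*(7*2)*(5*4)*(3*10)*(11*6)*(9*8))).
by rewrite /= !subrr !addr0.
Qed.

(* the linear map sending the basis element k of {malg K[T]} to f k; locked
   because unification otherwise unfolds it down to finite supports *)
HB.lock Definition lext (K : comNzRingType) (T : choiceType) (V : lmodType K)
    (f : T -> V) (x : {malg K[T]}) : V :=
  \sum_(k <- msupp x) x@_k *: f k.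

Section LinearExtension.
Variables (K : comNzRingType) (T : choiceType) (V : lmodType K).
Implicit Types (f : T -> V) (x y : {malg K[T]}).

Lemma lextE f x : lext f x = \sum_(k <- msupp x) x@_k *: f k.
Proof. by rewrite lext.unlock. Qed.

Lemma lextEw f x (d : {fset T}) : (msupp x `<=` d)%fset ->
  lext f x = \sum_(k <- d) x@_k *: f k.
Proof.
move=> le; rewrite lextE (big_fset_incl _ le) // => k _ /mcoeff_outdom ->.
by rewrite scale0r.
Qed.

Lemma lext_is_linear f : linear (lext f).
Proof.
move=> a x y; pose d := (msupp x `|` msupp y)%fset.
have lex : (msupp x `<=` d)%fset by apply: fsubsetUl.
have ley : (msupp y `<=` d)%fset by apply: fsubsetUr.
have lexy : (msupp (a *: x + y) `<=` d)%fset.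
  apply: fsubset_trans (msuppD_le _ _) _; rewrite fsubUset ley andbT.
  exact: fsubset_trans (msuppZ_le _ _) lex.
rewrite (lextEw f lex) (lextEw f ley) (lextEw f lexy) scaler_sumr -big_split /=.
by apply: eq_bigr => k _; rewrite mcoeffD mcoeffZ scalerDl scalerA.
Qed.

HB.instance Definition _ f :=
  GRing.isLinear.Build K {malg K[T]} V _ (lext f) (lext_is_linear f).

Lemma lextU f k : lext f << k >> = f k.
Proof. by rewrite lextE msuppU oner_eq0 big_seq_fset1 mcoeffUU scale1r. Qed.

Lemma linear_eq (f g : {linear {malg K[T]} -> V}) :
  (forall k, f << k >> = g << k >>) -> f =1 g.
Proof.
move=> fg x; rewrite (monalgE x) !raddf_sum; apply: eq_bigr => k _ /=.
have -> : << x@_k *g k >> = x@_k *: << k >> :> {malg K[T]}.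
  by apply/malgP => l; rewrite mcoeffZ !mcoeffU mulrnAr mulr1.
by rewrite !linearZ fg.
Qed.

Lemma linear_ext (f g : {malg K[T]} -> V) : linear f -> linear g ->
  (forall k, f << k >> = g << k >>) -> f =1 g.
Proof.
move=> lf lg.
pose f' := HB.pack_for {linear {malg K[T]} -> V} f (GRing.isLinear.Build _ _ _ _ f lf).
pose g' := HB.pack_for {linear {malg K[T]} -> V} g (GRing.isLinear.Build _ _ _ _ g lg).
exact: (linear_eq (f := f') (g := g')).
Qed.

End LinearExtension.

Section BilinearExtension.
Variables (K : comNzRingType) (T U : choiceType) (V : lmodType K).
Implicit Types (h : T -> U -> V) (x : {malg K[T]}) (y : {malg K[U]}).

Definition lext2 h x y : V := lext (fun k => lext (h k) y) x.

Lemma lext2Pl h a x x' y :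
  lext2 h (a *: x + x') y = a *: lext2 h x y + lext2 h x' y.
Proof. exact: lext_is_linear. Qed.

Lemma lext2Pr h a x y y' :
  lext2 h x (a *: y + y') = a *: lext2 h x y + lext2 h x y'.
Proof.
rewrite /lext2 !(lextE _ x).
rewrite scaler_sumr -big_split /=.
apply: eq_bigr => k _; rewrite lext_is_linear scalerDr !scalerA.
by rewrite mulrC.
Qed.

Lemma lext2U h k l : lext2 h << k >> << l >> = h k l.
Proof. by rewrite /lext2 !lextU. Qed.

Lemma lext20l h y : lext2 h 0 y = 0.
Proof. exact: raddf0. Qed.

Lemma lext20r h x : lext2 h x 0 = 0.
Proof. by have := lext2Pr h (-1) x 0 0; rewrite !scaleN1r !addNr. Qed.

Lemma lext2_suml (I : Type) (r : seq I) (g : I -> {malg K[T]}) h y :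
  lext2 h (\sum_(i <- r) g i) y = \sum_(i <- r) lext2 h (g i) y.
Proof. by rewrite /lext2 raddf_sum. Qed.

Lemma lext2_sumr (I : Type) (r : seq I) (g : I -> {malg K[U]}) h x :
  lext2 h x (\sum_(i <- r) g i) = \sum_(i <- r) lext2 h x (g i).
Proof.
elim/big_rec2: _ => [|i _ z _ <-].
  exact: lext20r.
by rewrite -[g i]scale1r lext2Pr !scale1r.
Qed.

End BilinearExtension.

Definition perms : Type := {n : nat & 'S_n}.
HB.instance Definition _ := Choice.on perms.

(* one-line notation, with letters 1, ..., n *)
Definition word (u : perms) : seq nat :=
  [seq (tagged u i).+1 | i <- enum 'I_(tag u)].

(* the permutation whose word is w; irrelevant (an identity permutation) when
   the letters of w are not exactly 1, ..., size w *)
Definition perm_of (w : seq nat) : perms :=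
  if [pick s : 'S_(size w) | word (Tagged (fun n => 'S_n) s) == w] is Some s
  then Tagged (fun n => 'S_n) s else Tagged (fun n => 'S_n) (1%g : 'S_(size w)).

Definition shift (n : nat) (w : seq nat) : seq nat := [seq (n + x)%N | x <- w].

(* listed with multiplicity; there are no repetitions when the letters of s and t
   are distinct *)
Fixpoint shuffle (s t : seq nat) : seq (seq nat) :=
  if s is x :: s' then
    (fix shuffle_s (t : seq nat) : seq (seq nat) :=
       if t is y :: t' then
         [seq x :: w | w <- shuffle s' t] ++ [seq y :: w | w <- shuffle_s t']
       else [:: s]) t
  else [:: t].

(* standardization: a letter is replaced by its rank among the letters of w,
   which are supposed to be distinct *)
Definition stdw (w : seq nat) : seq nat :=
  [seq count (fun y => y <= x)%N w | x <- w].

Definition std (w : seq nat) : perms := perm_of (stdw w).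

Definition permword (w : seq nat) := perm_eq w (iota 1 (size w)).

Lemma size_word u : size (word u) = tag u.
Proof. by rewrite size_map size_enum_ord. Qed.

Lemma word_uniq u : uniq (word u).
Proof.
rewrite map_inj_uniq ?enum_uniq // => i j [] /val_inj; exact: perm_inj.
Qed.

Lemma word_le u x : x \in word u -> (0 < x <= tag u)%N.
Proof. by case/mapP=> i _ ->; rewrite ltn_ord. Qed.

Lemma permwordP w : uniq w -> (forall x, x \in w -> 0 < x <= size w)%N ->
  permword w.
Proof.
move=> Uw lew; apply: uniq_perm; rewrite ?iota_uniq //.
have sw : {subset w <= iota 1 (size w)}.
  by move=> x /lew; rewrite mem_iota add1n ltnS.
by case: (uniq_min_size Uw sw); rewrite ?size_iota.
Qed.

Lemma permword_word u : permword (word u).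
Proof.
by apply: permwordP (word_uniq u) _ => x /word_le; rewrite size_word.
Qed.

Lemma word_inj : injective word.
Proof.
case=> n s [m t] eqst.
have enm : n = m by move/(congr1 size): (eqst); rewrite !size_word.
subst m; congr existT; apply/permP => i; apply: val_inj.
move/eq_in_map: eqst => /(_ i); rewrite mem_enum => /(_ isT).
by case.
Qed.

Lemma perm_ofK w : permword w -> word (perm_of w) = w.
Proof.
move=> pw; rewrite /perm_of; case: pickP => [s /eqP // | noS].
have lew (i : 'I_(size w)) : (0 < nth 0%N w i <= size w)%N.
  have := mem_nth 0%N (ltn_ord i).
  by rewrite (perm_mem pw) mem_iota add1n ltnS.
have lew' (i : 'I_(size w)) : ((nth 0%N w i).-1 < size w)%N.
  by case: (nth 0%N w i) (lew i) => [|k] // /andP[].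
have injf : injective (fun i => Ordinal (lew' i)).
  move=> i j [] eij; apply: val_inj; apply/eqP.
  rewrite -(nth_uniq 0%N (ltn_ord i) (ltn_ord j)); last first.
    by rewrite (perm_uniq pw) iota_uniq.
  case: (nth 0%N w i) (nth 0%N w j) eij (lew i) (lew j) => [|a] [|b] //= -> _ _.
  by rewrite eqxx.
have /eqP[] := noS (perm injf); apply: (@eq_from_nth _ 0%N).
  by rewrite size_word.
move=> i; rewrite size_word /= => lti.
rewrite (nth_map (Ordinal lti)) ?size_enum_ord // permE /=.
rewrite nth_enum_ord // prednK //.
by have /andP[] := lew (Ordinal lti).
Qed.

Lemma wordK : cancel word perm_of.
Proof. by move=> u; apply: word_inj; rewrite perm_ofK ?permword_word. Qed.

Lemma tag_perm_of w : tag (perm_of w) = size w.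
Proof. by rewrite /perm_of; case: pickP. Qed.

Lemma shuffle0s t : shuffle [::] t = [:: t]. Proof. by []. Qed.
Lemma shuffles0 s : shuffle s [::] = [:: s]. Proof. by case: s. Qed.
Lemma shuffle_cons x s y t : shuffle (x :: s) (y :: t) =
  [seq x :: w | w <- shuffle s (y :: t)] ++ [seq y :: w | w <- shuffle (x :: s) t].
Proof. by []. Qed.

Lemma shuffle_ind (P : seq nat -> seq nat -> Prop) :
  (forall t, P [::] t) -> (forall x s, P (x :: s) [::]) ->
  (forall x s y t, P s (y :: t) -> P (x :: s) t -> P (x :: s) (y :: t)) ->
  forall s t, P s t.
Proof.
move=> P0 P1 P2; elim=> [|x s IHs]; first exact: P0.
by elim=> [|y t IHt]; [exact: P1 | exact: P2].
Qed.

Lemma shuffle_perm s t w : w \in shuffle s t -> perm_eq w (s ++ t).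
Proof.
move: s t w; apply: shuffle_ind => [t w | x s w | x s y t IH1 IH2 w].
- by rewrite inE => /eqP ->.
- by rewrite inE => /eqP ->; rewrite cats0.
rewrite shuffle_cons mem_cat => /orP[] /mapP[w' w'in ->].
  by rewrite /= perm_cons IH1.
apply/seq.permP => p; have /seq.permP/(_ p) := IH2 _ w'in.
by rewrite /= !count_cat /=; lia.
Qed.

Lemma shuffle_map (f : nat -> nat) s t :
  shuffle (map f s) (map f t) = map (map f) (shuffle s t).
Proof.
move: s t; apply: shuffle_ind => // x s y t IH1 IH2.
rewrite [map f _]/= [map f (y :: t)]/= shuffle_cons -[f y :: _]/(map f (y :: t)).
rewrite IH1 -[f x :: _]/(map f (x :: s)) IH2 shuffle_cons map_cat -!map_comp.
by [].
Qed.

Section ShuffleSum.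
Variable V : nmodType.
Implicit Types (s t u : seq nat) (phi : seq nat -> V).

Lemma sum_shuffle_cons x s y t phi :
  \sum_(w <- shuffle (x :: s) (y :: t)) phi w =
  \sum_(w <- shuffle s (y :: t)) phi (x :: w)
  + \sum_(w <- shuffle (x :: s) t) phi (y :: w).
Proof. by rewrite shuffle_cons big_cat !big_map. Qed.

Lemma sum_shuffleA s t u phi :
  \sum_(w <- shuffle s t) \sum_(r <- shuffle w u) phi r =
  \sum_(w <- shuffle t u) \sum_(r <- shuffle s w) phi r.
Proof.
have [n le_n] := ubnP (size s + size t + size u)%N.
elim: n s t u phi le_n => // n IHn [|x s] t u phi le_n.
  rewrite shuffle0s big_seq1; apply: eq_bigr => w _.
  by rewrite shuffle0s big_seq1.
case: t le_n => [|y t] le_n.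
  by rewrite shuffles0 !big_seq1.
case: u le_n => [|z u] le_n.
  rewrite shuffles0 big_seq1; apply: eq_bigr => w _.
  by rewrite shuffles0 big_seq1.
have -> : \sum_(w <- shuffle (x :: s) (y :: t)) \sum_(r <- shuffle w (z :: u)) phi r
  = \sum_(w <- shuffle s (y :: t)) \sum_(r <- shuffle w (z :: u)) phi (x :: r)
  + \sum_(w <- shuffle (x :: s) t) \sum_(r <- shuffle w (z :: u)) phi (y :: r)
  + \sum_(w <- shuffle (x :: s) (y :: t)) \sum_(r <- shuffle w u) phi (z :: r).
  rewrite !sum_shuffle_cons.
  under eq_bigr do rewrite sum_shuffle_cons.
  under [X in _ + X = _]eq_bigr do rewrite sum_shuffle_cons.
  by rewrite !big_split /= addrACA.
have -> : \sum_(w <- shuffle (y :: t) (z :: u)) \sum_(r <- shuffle (x :: s) w) phi r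
  = \sum_(w <- shuffle (y :: t) (z :: u)) \sum_(r <- shuffle s w) phi (x :: r)
  + \sum_(w <- shuffle t (z :: u)) \sum_(r <- shuffle (x :: s) w) phi (y :: r)
  + \sum_(w <- shuffle (y :: t) u) \sum_(r <- shuffle (x :: s) w) phi (z :: r).
  rewrite !sum_shuffle_cons.
  under eq_bigr do rewrite sum_shuffle_cons.
  under [X in _ + X = _]eq_bigr do rewrite sum_shuffle_cons.
  by rewrite !big_split /= addrACA !addrA.
by rewrite !IHn //=; move: le_n => /=; lia.
Qed.

Definition decon (psi : seq nat -> seq nat -> V) w : V :=
  \sum_(0 <= i < (size w).+1) psi (take i w) (drop i w).

Lemma decon_cons psi x w :
  decon psi (x :: w) = psi [::] (x :: w) + decon (fun a b => psi (x :: a) b) w.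
Proof. by rewrite /decon big_nat_recl. Qed.

Lemma eq_decon psi psi' w : (forall a b, psi a b = psi' a b) ->
  decon psi w = decon psi' w.
Proof. by move=> e; apply: eq_bigr => i _; apply: e. Qed.

Lemma deconD psi psi' w :
  decon psi w + decon psi' w = decon (fun a b => psi a b + psi' a b) w.
Proof. by rewrite /decon big_split. Qed.

Lemma sum_shuffle_decon s t psi :
  \sum_(w <- shuffle s t) decon psi w =
  decon (fun a b => decon (fun c d =>
    \sum_(p <- shuffle a c) \sum_(q <- shuffle b d) psi p q) t) s.
Proof.
move: s t psi; apply: shuffle_ind => [t | x s | x s y t IH1 IH2] psi.
- rewrite shuffle0s big_seq1 /decon /= big_nat1 /=.
  by apply: eq_bigr => i _; rewrite !big_seq1.
- rewrite shuffles0 big_seq1 /decon /=; apply: eq_bigr => i _.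
  by rewrite big_nat1 /= !shuffles0 !big_seq1.
rewrite sum_shuffle_cons.
under eq_bigr do rewrite decon_cons.
under [X in _ + X = _]eq_bigr do rewrite decon_cons.
rewrite !big_split /= addrACA -(sum_shuffle_cons x s y t (psi [::])) IH1 IH2.
rewrite !decon_cons shuffle0s !big_seq1 -!addrA; congr (_ + _).
rewrite [LHS]addrCA; congr (_ + _).
  by apply: eq_decon => c d; rewrite !shuffle0s !big_seq1.
rewrite deconD; apply: eq_decon => a b.
rewrite !decon_cons !shuffles0 !big_seq1 -addrA deconD; congr (_ + _).
by apply: eq_decon => c d; rewrite sum_shuffle_cons.
Qed.

End ShuffleSum.

Lemma size_stdw w : size (stdw w) = size w.
Proof. exact: size_map. Qed.

Lemma count0 (p : pred nat) w : (forall y, y \in w -> ~~ p y) -> count p w = 0%N.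
Proof.
by move=> pw; apply/eqP; rewrite -leqn0 leqNgt -has_count -all_predC; apply/allP.
Qed.

Lemma permword_stdw w : uniq w -> permword (stdw w).
Proof.
move=> Uw; apply: permwordP.
  rewrite map_inj_in_uniq // => x y xw yw exy.
  wlog ltxy : x y xw yw exy / (x < y)%N.
    move=> H; case: (ltngtP x y) => // lt; first exact: H.
    by apply/esym; apply: H.
  have : (count (fun z => z <= x) w + (y \in w) <= count (fun z => z <= y) w)%N.
    rewrite -(count_uniq_mem y Uw) -count_predUI.
    rewrite [X in (_ + X <= _)%N]count0 ?addn0.
      by apply: sub_count => z /= /orP[|/eqP ->] //; lia.
    by move=> z _ /=; apply/negP => /andP[lezx /eqP ezy]; lia.
  by rewrite yw exy; lia.
move=> _ /mapP[x xw ->]; rewrite size_stdw count_size andbT -has_count.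
by apply/hasP; exists x => /=.
Qed.

Lemma word_std w : uniq w -> word (std w) = stdw w.
Proof. by move=> Uw; rewrite perm_ofK ?permword_stdw. Qed.

Lemma stdw_word u : stdw (word u) = word u.
Proof.
rewrite /stdw -[RHS]map_id; apply/eq_in_map => x /word_le /andP[x0 lex].
rewrite (seq.permP (permword_word u)) size_word.
have -> : tag u = (x + (tag u - x))%N by lia.
rewrite iotaD count_cat.
rewrite [X in (X + _)%N](_ : _ = size (iota 1 x)); last first.
  by apply/eqP; rewrite -all_count; apply/allP => y; rewrite mem_iota /=; lia.
rewrite [X in (_ + X)%N]count0 ?size_iota ?addn0 // => y.
by rewrite mem_iota /=; lia.
Qed.

Lemma sum_shuffle_std (V : nmodType) (s t : seq nat) (n : nat)
    (phi : seq nat -> V) :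
  uniq s -> uniq t -> (forall x, x \in s -> x <= n)%N ->
  (forall x, x \in t -> n < x)%N ->
  \sum_(w <- shuffle (stdw s) (shift (size s) (stdw t))) phi w =
  \sum_(w <- shuffle s t) phi (stdw w).
Proof.
move=> Us Ut les ltt.
pose f x := count (fun y => y <= x)%N (s ++ t).
have -> : stdw s = map f s.
  apply/eq_in_map => x xs; rewrite /f count_cat.
  rewrite [X in (_ + X)%N]count0 ?addn0 // => y /ltt /=.
  by have := les _ xs; lia.
have -> : shift (size s) (stdw t) = map f t.
  rewrite /shift -map_comp; apply/eq_in_map => x xt; rewrite /f /= count_cat.
  congr addn; apply/esym/eqP; rewrite -all_count.
  by apply/allP => y /les /=; have := ltt _ xt; lia.
rewrite shuffle_map big_map big_seq [RHS]big_seq; apply: eq_bigr => w /shuffle_perm pw.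
by congr phi; apply/eq_map => x; rewrite /f (seq.permP pw).
Qed.

Definition FQSym (K : fieldType) : Type := {malg K[perms]}.
HB.instance Definition _ (K : fieldType) := GRing.Lmodule.on (FQSym K).

(* the tensor square of FQSym, as the free module on pairs of permutations:
   << (u, v) >> is the tensor product of F u and F v *)
Definition FQSym2 (K : fieldType) : Type := {malg K[(perms * perms)%type]}.
HB.instance Definition _ (K : fieldType) := GRing.Lmodule.on (FQSym2 K).

HB.lock Definition F (K : fieldType) (u : perms) : FQSym K := << u >>.
Arguments F {K} u.

Section FQSym.
Variable K : fieldType.
Implicit Types (u v : perms) (x y z : FQSym K).

(* the pure tensor of x and y *)
Definition tens x y : FQSym2 K :=
  lext2 (fun u v => << (u, v) >>) x y.

Definition FQSym_mulF u v : FQSym K :=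
  \sum_(w <- shuffle (word u) (shift (tag u) (word v))) F (perm_of w).

Definition FQSym_mul x y : FQSym K :=
  lext2 FQSym_mulF x y.

Definition FQSym_one : FQSym K := F (Tagged (fun n => 'S_n) (1%g : 'S_0)).

Definition coprodF u : FQSym2 K :=
  \sum_(i < (tag u).+1)
     tens (F (std (take i (word u)))) (F (std (drop i (word u)))).

Definition coprod (x : FQSym K) : FQSym2 K := lext coprodF x.

Lemma FQSym_mulPl (a : K) x y z :
  FQSym_mul (a *: x + y) z = a *: FQSym_mul x z + FQSym_mul y z.
Proof. exact: lext2Pl. Qed.

Lemma FQSym_mulPr (a : K) x y z :
  FQSym_mul z (a *: x + y) = a *: FQSym_mul z x + FQSym_mul z y.
Proof. exact: lext2Pr. Qed.

Lemma FQSym_mulU u v : FQSym_mul (F u) (F v) = FQSym_mulF u v.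
Proof. rewrite F.unlock; exact: lext2U. Qed.

Lemma FQSym_mul_suml (I : Type) (r : seq I) (g : I -> FQSym K) y :
  FQSym_mul (\sum_(i <- r) g i) y = \sum_(i <- r) FQSym_mul (g i) y.
Proof. exact: lext2_suml. Qed.

Lemma FQSym_mul_sumr (I : Type) (r : seq I) (g : I -> FQSym K) x :
  FQSym_mul x (\sum_(i <- r) g i) = \sum_(i <- r) FQSym_mul x (g i).
Proof. exact: lext2_sumr. Qed.

Lemma FQSym_linear_ext (V : lmodType K) (f g : FQSym K -> V) :
  linear f -> linear g -> (forall u, f (F u) = g (F u)) -> f =1 g.
Proof. by rewrite F.unlock; apply: linear_ext. Qed.

Lemma shuffle_permword u v w :
  w \in shuffle (word u) (shift (tag u) (word v)) ->
  permword w /\ size w = (tag u + tag v)%N.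
Proof.
move=> /shuffle_perm pw.
have sw : size w = (tag u + tag v)%N.
  by rewrite (perm_size pw) size_cat size_word [size (shift _ _)]size_map size_word.
split=> //; rewrite /permword sw iotaD (perm_trans pw) // perm_cat //.
  by have := permword_word u; rewrite /permword size_word.
rewrite addnC iotaDl; apply: perm_map.
by have := permword_word v; rewrite /permword size_word.
Qed.

Lemma FQSym_one_neq0 : FQSym_one != 0.
Proof. by rewrite /FQSym_one F.unlock monalgU_eq0 oner_eq0. Qed.

Lemma FQSym_mulA : associative FQSym_mul.
Proof.
move=> x y z; move: x; apply: FQSym_linear_ext => [a x x'|a x x'|u].
- by rewrite FQSym_mulPl.
- by rewrite !FQSym_mulPl.
move: y; apply: FQSym_linear_ext => [a y y'|a y y'|v].
- by rewrite !(FQSym_mulPl, FQSym_mulPr).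
- by rewrite !(FQSym_mulPl, FQSym_mulPr).
move: z; apply: FQSym_linear_ext => [a z z'|a z z'|w].
- by rewrite !FQSym_mulPr.
- by rewrite !FQSym_mulPr.
rewrite !FQSym_mulU /FQSym_mulF.
rewrite FQSym_mul_sumr FQSym_mul_suml.
transitivity (\sum_(s <- shuffle (shift (tag u) (word v))
                          (shift (tag u + tag v) (word w)))
    \sum_(r <- shuffle (word u) s) (F (perm_of r) : FQSym K)); last first.
  rewrite -sum_shuffleA big_seq [RHS]big_seq; apply: eq_bigr => s.
  move=> /shuffle_permword[ps szs].
  by rewrite FQSym_mulU /FQSym_mulF perm_ofK // tag_perm_of szs.
have -> : shift (tag u + tag v) (word w) =
    shift (tag u) (shift (tag v) (word w)).
  by rewrite /shift -map_comp; apply: eq_map => k /=; rewrite addnA.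
rewrite [shift (tag u) (word v)]/(map _ _) shuffle_map big_map.
rewrite big_seq [RHS]big_seq; apply: eq_bigr => s /shuffle_permword[ps szs].
by rewrite FQSym_mulU /FQSym_mulF perm_ofK.
Qed.

Lemma FQSym_mul1x : left_id FQSym_one FQSym_mul.
Proof.
apply: FQSym_linear_ext => [a x y|a x y|u] //; first by rewrite FQSym_mulPr.
rewrite FQSym_mulU /FQSym_mulF {1}/word enum_ord0 big_seq1.
by rewrite /shift [map _ _]map_id wordK.
Qed.

Lemma FQSym_mulx1 : right_id FQSym_one FQSym_mul.
Proof.
apply: FQSym_linear_ext => [a x y|a x y|u] //; first by rewrite FQSym_mulPl.
rewrite FQSym_mulU /FQSym_mulF {2}/word enum_ord0 shuffles0 big_seq1.
by rewrite wordK.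
Qed.

Lemma FQSym_mulDl : left_distributive FQSym_mul +%R.
Proof. by move=> x y z; rewrite -[x]scale1r FQSym_mulPl !scale1r. Qed.

Lemma FQSym_mulDr : right_distributive FQSym_mul +%R.
Proof. by move=> z x y; rewrite -[x]scale1r FQSym_mulPr !scale1r. Qed.

HB.instance Definition _ := GRing.Zmodule_isNzRing.Build (FQSym K)
  FQSym_mulA FQSym_mul1x FQSym_mulx1 FQSym_mulDl FQSym_mulDr FQSym_one_neq0.

Lemma FQSym_scaleAl (a : K) x y : a *: (x * y) = (a *: x) * y.
Proof.
have := FQSym_mulPl a x 0 y; rewrite addr0 => e; apply/esym.
by rewrite [LHS]e (mul0r y : FQSym_mul 0 y = 0) addr0.
Qed.

Lemma FQSym_scaleAr (a : K) x y : a *: (x * y) = x * (a *: y).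
Proof.
have := FQSym_mulPr a y 0 x; rewrite addr0 => e; apply/esym.
by rewrite [LHS]e (mulr0 x : FQSym_mul x 0 = 0) addr0.
Qed.

HB.instance Definition _ :=
  GRing.Lmodule_isLalgebra.Build K (FQSym K) FQSym_scaleAl.
HB.instance Definition _ :=
  GRing.Lalgebra_isAlgebra.Build K (FQSym K) FQSym_scaleAr.

Lemma FQSym_mulFE u v : F u * F v =
  \sum_(w <- shuffle (word u) (shift (tag u) (word v))) F (perm_of w).
Proof. exact: FQSym_mulU. Qed.

Lemma tensPl (a : K) x y z : tens (a *: x + y) z = a *: tens x z + tens y z.
Proof. exact: lext2Pl. Qed.

Lemma tensPr (a : K) x y z : tens z (a *: x + y) = a *: tens z x + tens z y.
Proof. exact: lext2Pr. Qed.

Lemma tens0l y : tens 0 y = 0.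
Proof. exact: lext20l. Qed.

Lemma tens0r x : tens x 0 = 0.
Proof. exact: lext20r. Qed.

Lemma tens_suml (I : Type) (r : seq I) (g : I -> FQSym K) y :
  tens (\sum_(i <- r) g i) y = \sum_(i <- r) tens (g i) y.
Proof. exact: lext2_suml. Qed.

Lemma tens_sumr (I : Type) (r : seq I) (g : I -> FQSym K) x :
  tens x (\sum_(i <- r) g i) = \sum_(i <- r) tens x (g i).
Proof. exact: lext2_sumr. Qed.

Lemma tensBl x y z : tens (x - y) z = tens x z - tens y z.
Proof. by rewrite addrC -scaleN1r tensPl scaleN1r addrC. Qed.

Lemma tensBr x y z : tens z (x - y) = tens z x - tens z y.
Proof. by rewrite addrC -scaleN1r tensPr scaleN1r addrC. Qed.

Lemma tensU u v : tens (F u) (F v) = << (u, v) >>.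
Proof. rewrite F.unlock; exact: lext2U. Qed.

Lemma coprod_is_linear : linear coprod.
Proof. exact: lext_is_linear. Qed.
HB.instance Definition _ :=
  GRing.isLinear.Build K (FQSym K) (FQSym2 K) _ coprod coprod_is_linear.

Lemma coprodU u : coprod (F u) = coprodF u.
Proof. rewrite F.unlock; exact: lextU. Qed.

Definition tens_mul (X Y : FQSym2 K) : FQSym2 K :=
  lext2 (fun p q => tens (F p.1 * F q.1) (F p.2 * F q.2)) X Y.

Lemma tens_mulPl (a : K) X Y Z :
  tens_mul (a *: X + Y) Z = a *: tens_mul X Z + tens_mul Y Z.
Proof. exact: lext2Pl. Qed.

Lemma tens_mulPr (a : K) X Y Z :
  tens_mul Z (a *: X + Y) = a *: tens_mul Z X + tens_mul Z Y.
Proof. exact: lext2Pr. Qed.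

Lemma tens_mul_suml (I : Type) (r : seq I) (g : I -> FQSym2 K) Y :
  tens_mul (\sum_(i <- r) g i) Y = \sum_(i <- r) tens_mul (g i) Y.
Proof. exact: lext2_suml. Qed.

Lemma tens_mul_sumr (I : Type) (r : seq I) (g : I -> FQSym2 K) X :
  tens_mul X (\sum_(i <- r) g i) = \sum_(i <- r) tens_mul X (g i).
Proof. exact: lext2_sumr. Qed.

Lemma tens_mulU u v u' v' :
  tens_mul (tens (F u) (F v)) (tens (F u') (F v')) =
  tens (F u * F u') (F v * F v').
Proof. by rewrite !tensU [LHS]lext2U. Qed.

Lemma tens_mulE x y z t :
  tens_mul (tens x y) (tens z t) = tens (x * z) (y * t).
Proof.
move: x; apply: FQSym_linear_ext => [a x x'|a x x'|u].
- by rewrite tensPl tens_mulPl.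
- by rewrite mulrDl -scalerAl tensPl.
move: y; apply: FQSym_linear_ext => [a y y'|a y y'|v].
- by rewrite tensPr tens_mulPl.
- by rewrite mulrDl -scalerAl tensPr.
move: z; apply: FQSym_linear_ext => [a z z'|a z z'|r].
- by rewrite tensPl tens_mulPr.
- by rewrite mulrDr -scalerAr tensPl.
move: t; apply: FQSym_linear_ext => [a t t'|a t t'|s].
- by rewrite tensPr tens_mulPr.
- by rewrite mulrDr -scalerAr tensPr.
exact: tens_mulU.
Qed.

Definition F2 (a b : seq nat) : FQSym2 K := tens (F (std a)) (F (std b)).

Lemma coprodFE u : coprodF u = decon F2 (word u).
Proof. by rewrite /decon size_word big_mkord. Qed.

Lemma F_std_mul (s t : seq nat) n : uniq s -> uniq t ->
  (forall k, k \in s -> k <= n)%N -> (forall k, k \in t -> 0 < k)%N ->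
  F (std s) * F (std t) = \sum_(w <- shuffle s (shift n t)) F (std w).
Proof.
move=> Us Ut les gt0t.
rewrite FQSym_mulFE !word_std // /std tag_perm_of size_stdw.
have stdsh : stdw (shift n t) = stdw t.
  rewrite /stdw -map_comp; apply: eq_map => k /=.
  by rewrite count_map; apply: eq_count => l /=; rewrite leq_add2l.
rewrite -stdsh (sum_shuffle_std (n := n)) //.
  by rewrite map_inj_uniq //; apply: addnI.
by move=> _ /mapP[k /gt0t k0 ->]; lia.
Qed.

Lemma coprodM x y : coprod (x * y) = tens_mul (coprod x) (coprod y).
Proof.
move: x; apply: FQSym_linear_ext => [a x x'|a x x'|u].
- by rewrite mulrDl -scalerAl linearP.
- by rewrite linearP tens_mulPl.
move: y; apply: FQSym_linear_ext => [a y y'|a y y'|v].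
- by rewrite mulrDr -scalerAr linearP.
- by rewrite linearP tens_mulPr.
rewrite FQSym_mulFE raddf_sum !coprodU !coprodFE.
transitivity (\sum_(w <- shuffle (word u) (shift (tag u) (word v))) decon F2 w).
  rewrite big_seq [RHS]big_seq; apply: eq_bigr => w /shuffle_permword[pw _] /=.
  by rewrite coprodU coprodFE perm_ofK.
rewrite sum_shuffle_decon {1 3}/decon.
rewrite tens_mul_suml.
apply: eq_bigr => i _; rewrite /decon.
rewrite tens_mul_sumr size_map; apply: eq_bigr => j _; rewrite tens_mulE.
rewrite /shift -map_take -map_drop -!/(shift _ _).
have le_u k : k \in word u -> (k <= tag u)%N by move=> /word_le /andP[].
have gt0_v k : k \in word v -> (0 < k)%N by move=> /word_le /andP[].
rewrite (F_std_mul (n := tag u)) ?take_uniq ?word_uniq //; first last.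
- by move=> k /mem_take /gt0_v.
- by move=> k /mem_take /le_u.
rewrite (F_std_mul (n := tag u)) ?drop_uniq ?word_uniq //; first last.
- by move=> k /mem_drop /gt0_v.
- by move=> k /mem_drop /le_u.
rewrite tens_suml.
apply: eq_bigr => p _.
by rewrite tens_sumr.
Qed.

Definition primitive : {pred FQSym K} :=
  [pred x | coprod x == tens x 1 + tens 1 x].

Record Prim := MkPrim { prim_val : FQSym K; _ : prim_val \in primitive }.

HB.instance Definition _ := [isSub for prim_val].
HB.instance Definition _ := [Choice of Prim by <:].

Lemma primitive_submod_closed : submod_closed primitive.
Proof.
split=> [|a x y]; rewrite !inE.
  by rewrite tens0l tens0r addr0 raddf0.
move=> /eqP px /eqP py; rewrite coprod_is_linear px py tensPl tensPr.
by rewrite scalerDr addrACA.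
Qed.

HB.instance Definition _ :=
  GRing.isSubmodClosed.Build K (FQSym K) primitive primitive_submod_closed.
HB.instance Definition _ := [SubChoice_isSubLmodule of Prim by <:].

Lemma commutator_primitive x y : x \in primitive -> y \in primitive ->
  x * y - y * x \in primitive.
Proof.
have tmDl (X Y Z : FQSym2 K) : tens_mul (X + Y) Z = tens_mul X Z + tens_mul Y Z.
  by rewrite -[X]scale1r tens_mulPl !scale1r.
have tmDr (X Y Z : FQSym2 K) : tens_mul Z (X + Y) = tens_mul Z X + tens_mul Z Y.
  by rewrite -[X]scale1r tens_mulPr !scale1r.
have cancel2 (P Q P' Q' A B : FQSym2 K) :
    P + A + (B + Q) - (P' + B + (A + Q')) = P - P' + (Q - Q').
  rewrite [B + Q]addrC addrACA [A + Q']addrC [P' + B + _]addrACA [B + A]addrC.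
  by rewrite [- (_ + (A + B))]opprD [LHS]addrACA subrr addr0 opprD [LHS]addrACA.
have coprod_mul z t : z \in primitive -> t \in primitive ->
    coprod (z * t) = tens (z * t) 1 + tens z t + (tens t z + tens 1 (z * t)).
  rewrite !inE => /eqP pz /eqP pt; rewrite coprodM pz pt.
  have := @mul1r (FQSym K); have := @mulr1 (FQSym K).
  move: (1 : FQSym K) => e mule emul.
  rewrite tmDl.
  rewrite (tmDr _ _ (tens z e)).
  rewrite (tmDr _ _ (tens e z)).
  rewrite (tens_mulE z).
  rewrite (tens_mulE z).
  rewrite (tens_mulE e).
  rewrite (tens_mulE e).
  by rewrite !mule !emul.
move=> px py; rewrite inE; apply/eqP.
have -> : coprod (x * y - y * x) = coprod (x * y) - coprod (y * x).
  exact: raddfB.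
rewrite (coprod_mul x y) // (coprod_mul y x) // cancel2.
by rewrite tensBl tensBr.
Qed.

Definition Prim_bracket (x y : Prim) : Prim :=
  MkPrim (commutator_primitive (valP x) (valP y)).

Lemma Prim_bracketPl (a : K) (x y z : Prim) :
  Prim_bracket (a *: x + y) z = a *: Prim_bracket x z + Prim_bracket y z.
Proof.
apply: val_inj; rewrite /= mulrDl mulrDr -scalerAl -scalerAr.
by rewrite scalerBr opprD addrACA.
Qed.

Lemma Prim_bracketPr (a : K) (x y z : Prim) :
  Prim_bracket z (a *: x + y) = a *: Prim_bracket z x + Prim_bracket z y.
Proof.
apply: val_inj; rewrite /= mulrDl mulrDr -scalerAl -scalerAr.
by rewrite scalerBr opprD addrACA.
Qed.

Lemma Prim_bracketxx (x : Prim) : Prim_bracket x x = 0.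
Proof. by apply: val_inj; rewrite /= subrr. Qed.

Lemma Prim_jacobi (x y z : Prim) :
  Prim_bracket x (Prim_bracket y z) + Prim_bracket y (Prim_bracket z x)
    + Prim_bracket z (Prim_bracket x y) = 0.
Proof.
by apply: val_inj; rewrite /= commutator_jacobi.
Qed.

HB.instance Definition _ := Lmodule_isLie.Build K Prim
  Prim_bracketPl Prim_bracketPr Prim_bracketxx Prim_jacobi.

End FQSym.

(* Main.v *)
From HB Require Import structures.
From mathcomp Require Import all_boot all_fingroup all_algebra.
From mathcomp Require Import finmap zify.
From mathcomp.classical Require Import boolp.
From mathcomp.multinomials Require Import monalg.
Require Import Defs.

Set Implicit Arguments.
Unset Strict Implicit.
Unset Printing Implicit Defensive.

Import GRing.Theory.

Local Open Scope ring_scope.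

(** Write H for FQSym, g for its Lie algebra of primitive elements, and H+ for
    the ideal spanned by the F u with u nonempty.  A family of primitive
    elements is found that generates g as a Lie algebra and generates a free
    associative subalgebra of H; these two properties give the universal
    property in characteristic 0.

    H itself is a free associative algebra.  The product F u * F c is F of the
    concatenation of u and c shifted, plus terms with more inversions
    ([mulF_lead]), and a nonempty permutation is in a unique way such a
    concatenation with c connected.  By triangularity H+ is a free left
    H-module on the F c with c connected ([mu_surj], [mu_inj]).  This allows
    Cohn's weak algorithm: in a relation between primitive elements x_i with
    coefficients a_i in H on the right, the constant terms of the a_i vanish
    as soon as the x_i are linearly independent modulo the product g H+, and
    dividing the a_i on the right by the F c then yields relations of smaller
    degree.  So homogeneous primitive elements forming a basis of g modulo the
    elements of g H+ are right independent over H ([gen_right_indep]), and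
    therefore algebraically free ([prod_eval_inj]).

    These elements also generate g.  A primitive element lying in g H+ is a
    sum of products of at least two primitive elements
    ([Jplus_decomposable]): this reflects the freeness of H over the
    subalgebra U generated by g, and is seen by applying the coproduct and
    reducing the right-hand tensor factor modulo the right ideal g H, because
    the coproduct of u h is then that of h multiplied by u on the left.  By
    induction on the degree, g lies in the associative subalgebra generated by
    the chosen elements ([gen_generates]).  Passing from associative to Lie
    generation uses the composite psi of the coproduct and the product: it
    multiplies a product of n primitive elements by 2^n up to shorter
    products, and a primitive element by 2, so in characteristic 0 a primitive
    element of the associative subalgebra generated by a Lie algebra of
    primitive elements belongs to that Lie algebra ([primitive_fil]).

    Finally, let a family be mapped to a Lie algebra h.  Sending a word
    x_1...x_n to the n-th part of [x_1,[x_2,...,[x_(n-1),x_n]]] in h defines a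
    linear map on the free associative algebra which, by the argument of
    Dynkin, Specht and Wever, sends the Lie polynomial of a bracketing to the
    value of that bracketing in h ([dynkin_div_word_eval]).  That value thus
    depends only on the polynomial, which defines the wanted morphism
    ([Prim_free]). *)

(** * Linear spans *)

Section Span.
Variables (K : pzRingType) (V : lmodType K).
Implicit Types (P Q : V -> Prop) (x y z : V).

(** An inductive span: a relation between values of linear maps, or the
    membership of their values in another span, is proved on generators only
    ([lspan_eq], [lspan_map]). *)
Inductive lspan P : V -> Prop :=
| lspan0 : lspan P 0
| lspan_cons a x y : P x -> lspan P y -> lspan P (a *: x + y).

Lemma lspan_gen P x : P x -> lspan P x.
Proof.
move=> Px; rewrite -[x]scale1r -[X in lspan _ X]addr0.
exact: lspan_cons Px (lspan0 P).
Qed.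

Lemma lspanP P a x y : lspan P x -> lspan P y -> lspan P (a *: x + y).
Proof.
move=> Px Py; elim: Px => [|b u v Pu _ IH]; first by rewrite scaler0 add0r.
by rewrite scalerDr scalerA -addrA; apply: lspan_cons.
Qed.

Lemma lspanZ P a x : lspan P x -> lspan P (a *: x).
Proof.
by move=> Px; rewrite -[X in lspan _ X]addr0; apply: lspanP Px (lspan0 P).
Qed.

Lemma lspanD P x y : lspan P x -> lspan P y -> lspan P (x + y).
Proof. by move=> Px; rewrite -[x]scale1r; apply: lspanP. Qed.

Lemma lspanB P x y : lspan P x -> lspan P y -> lspan P (x - y).
Proof. by move=> Px Py; rewrite addrC -scaleN1r; apply: lspanP. Qed.

Lemma lspan_sum P (I : eqType) (r : seq I) (g : I -> V) :
  (forall i, i \in r -> lspan P (g i)) -> lspan P (\sum_(i <- r) g i).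
Proof.
move=> Pg; rewrite big_seq; elim/big_rec: _ => [|i y /Pg Pi Py].
  exact: lspan0.
exact: lspanD.
Qed.

End Span.

Section SpanLinear.
Variables (K : pzRingType) (V W : lmodType K).
Implicit Types (P : V -> Prop) (Q : W -> Prop).

Lemma lin0 (f : V -> W) : linear f -> f 0 = 0.
Proof. by move=> lf; have := lf (-1) 0 0; rewrite !scaleN1r !addNr. Qed.

Lemma linZ (f : V -> W) : linear f -> forall a x, f (a *: x) = a *: f x.
Proof. by move=> lf a x; have := lf a x 0; rewrite lin0 // !addr0. Qed.

Lemma linD (f : V -> W) : linear f -> forall x y, f (x + y) = f x + f y.
Proof. by move=> lf x y; have := lf 1 x y; rewrite !scale1r. Qed.

Lemma linB (f : V -> W) : linear f -> forall x y, f (x - y) = f x - f y.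
Proof. by move=> lf x y; rewrite addrC -scaleN1r lf scaleN1r addrC. Qed.

Lemma lin_sum (f : V -> W) : linear f ->
  forall I (r : seq I) (g : I -> V), f (\sum_(i <- r) g i) = \sum_(i <- r) f (g i).
Proof.
move=> lf I r g; elim: r => [|i r IH]; first by rewrite !big_nil lin0.
by rewrite !big_cons linD // IH.
Qed.

Lemma lspan_map P Q (f : V -> W) z : linear f ->
  (forall x, P x -> lspan Q (f x)) -> lspan P z -> lspan Q (f z).
Proof.
move=> lf PQ; elim=> [|a x y /PQ Px _ Py]; first by rewrite lin0 //; apply: lspan0.
by rewrite lf; apply: lspanP.
Qed.

Lemma lspan_eq P (f g : V -> W) z : linear f -> linear g ->
  (forall x, P x -> f x = g x) -> lspan P z -> f z = g z.
Proof.
move=> lf lg fg; elim=> [|a x y /fg e _ IH]; first by rewrite !lin0.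
by rewrite lf lg e IH.
Qed.

End SpanLinear.

Lemma lspan_sub (K : pzRingType) (V : lmodType K) (P Q : V -> Prop) z :
  (forall x, P x -> lspan Q x) -> lspan P z -> lspan Q z.
Proof. by move=> PQ; apply: (lspan_map (f := id)). Qed.

Lemma lspanS (K : pzRingType) (V : lmodType K) (P Q : V -> Prop) z :
  (forall x, P x -> Q x) -> lspan P z -> lspan Q z.
Proof. by move=> PQ; apply: lspan_sub => x /PQ; apply: lspan_gen. Qed.

(** * Coordinates, degree and counit *)

Section Basics.
Variable K : fieldType.
Local Notation H := (FQSym K).
Local Notation HH := (FQSym2 K).
Implicit Types (u v p q : perms) (x y z : H) (T : HH).

Definition empty_perm : perms := Tagged (fun n => 'S_n) (1%g : 'S_0).

Lemma tag_empty : tag empty_perm = 0%N. Proof. by []. Qed.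

Lemma word_empty : word empty_perm = [::].
Proof. by apply: size0nil; rewrite size_word. Qed.

Lemma tag_eq0 u : tag u = 0%N -> u = empty_perm.
Proof.
by move=> u0; apply: word_inj; rewrite word_empty; apply: size0nil; rewrite size_word.
Qed.

Lemma FQSym_oneE : 1 = F empty_perm :> H. Proof. by []. Qed.

Definition coef p x : K := mcoeff p (x : {malg K[perms]}).

Lemma coef_linear p : linear (coef p : H -> K^o).
Proof. by move=> a x y; rewrite /coef mcoeffD mcoeffZ. Qed.

Lemma coef0 p : coef p (0 : H) = 0. Proof. exact: mcoeff0. Qed.
Lemma coefD p x y : coef p (x + y) = coef p x + coef p y. Proof. exact: mcoeffD. Qed.
Lemma coefB p x y : coef p (x - y) = coef p x - coef p y. Proof. exact: mcoeffB. Qed.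
Lemma coefZ p a x : coef p (a *: x) = a * coef p x. Proof. exact: mcoeffZ. Qed.
Lemma coef_sum p I (r : seq I) (g : I -> H) :
  coef p (\sum_(i <- r) g i) = \sum_(i <- r) coef p (g i).
Proof. exact: (lin_sum (coef_linear p)). Qed.

Lemma coefF p u : coef p (F u : H) = (u == p)%:R.
Proof. by rewrite /coef F.unlock mcoeffU. Qed.

Lemma coef_eq x y : (forall p, coef p x = coef p y) -> x = y.
Proof. by move=> e; apply/malgP. Qed.

Lemma coef_neq0 x : x != 0 -> exists p, coef p x != 0.
Proof.
move=> x0; have /fset0Pn[p px] : msupp (x : {malg K[perms]}) != fset0.
  apply: contra x0 => /eqP e; apply/eqP/coef_eq => k; rewrite coef0.
  by apply: mcoeff_outdom; rewrite e in_fset0.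
by exists p; rewrite /coef mcoeff_neq0.
Qed.

Lemma FQSym_spanF x : lspan (fun z : H => exists u, z = F u) x.
Proof.
rewrite [x]monalgE; apply: lspan_sum => u _.
have -> : << (x : {malg K[perms]})@_u *g u >> = coef u x *: F u :> H.
  apply/malgP => l; rewrite [RHS]mcoeffZ F.unlock !mcoeffU mulrnAr mulr1.
  by [].
by apply: lspanZ; apply: lspan_gen; exists u.
Qed.

Lemma FQSym2_span T : lspan (fun z : HH => exists u v, z = tens (F u) (F v)) T.
Proof.
rewrite [T]monalgE; apply: lspan_sum => -[u v] _.
have -> : << (T : {malg K[(perms * perms)%type]})@_(u, v) *g (u, v) >> =
    mcoeff (u, v) (T : {malg K[(perms * perms)%type]}) *: tens (F u) (F v) :> HH.
  apply/malgP => l; rewrite [RHS]mcoeffZ tensU !mcoeffU mulrnAr mulr1.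
  by [].
by apply: lspanZ; apply: lspan_gen; exists u, v.
Qed.

Lemma mull_linear x : linear (fun y => x * y).
Proof. by move=> a y z; rewrite mulrDr scalerAr. Qed.

Lemma mulr_linear x : linear (fun y => y * x).
Proof. by move=> a y z; rewrite mulrDl scalerAl. Qed.

Lemma tensl_linear y : linear (fun x => tens x y).
Proof. by move=> a x x'; rewrite tensPl. Qed.

Lemma tensr_linear x : linear (fun y => tens x y).
Proof. by move=> a y y'; rewrite tensPr. Qed.

Lemma tens_mull_linear T : linear (tens_mul T).
Proof. by move=> a X Y; rewrite tens_mulPr. Qed.

Definition mu T : H := lext (fun p : (perms * perms)%type => F p.1 * F p.2) T.

Lemma mu_linear : linear mu. Proof. exact: lext_is_linear. Qed.

Lemma mu_tens x y : mu (tens x y) = x * y.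
Proof.
move: x; apply: FQSym_linear_ext; first by move=> a x x'; rewrite tensPl mu_linear.
  exact: mulr_linear.
move=> u; move: y; apply: FQSym_linear_ext; first by move=> a x x'; rewrite tensPr mu_linear.
  exact: mull_linear.
by move=> v; rewrite tensU /mu lextU.
Qed.

(** The map coef p (x) id.  The elements of H (x) J, for a subspace J, are the
    tensors whose slices are all in J; this replaces the quotient H / J. *)
Definition lslice p T : H := lext (fun r : (perms * perms)%type => (r.1 == p)%:R *: F r.2) T.

Lemma lslice_linear p : linear (lslice p). Proof. exact: lext_is_linear. Qed.

Lemma lslice_tens p x y : lslice p (tens x y) = coef p x *: y.
Proof.
move: x; apply: FQSym_linear_ext.
- by move=> a x x'; rewrite tensPl lslice_linear.
- by move=> a x x'; rewrite coef_linear scalerDl scalerA.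
move=> u; move: y; apply: FQSym_linear_ext.
- by move=> a x x'; rewrite tensPr lslice_linear.
- by move=> a x x'; rewrite scalerDr !scalerA mulrC.
by move=> v; rewrite tensU /lslice lextU coefF.
Qed.

Definition rslice p T : H := lext (fun r : (perms * perms)%type => (r.2 == p)%:R *: F r.1) T.

Lemma rslice_linear p : linear (rslice p). Proof. exact: lext_is_linear. Qed.

Lemma rslice_tens p x y : rslice p (tens x y) = coef p y *: x.
Proof.
move: x; apply: FQSym_linear_ext.
- by move=> a x x'; rewrite tensPl rslice_linear.
- by move=> a x x'; rewrite scalerDr !scalerA mulrC.
move=> u; move: y; apply: FQSym_linear_ext.
- by move=> a x x'; rewrite tensPr rslice_linear.
- by move=> a x x'; rewrite coef_linear scalerDl scalerA.
by move=> v; rewrite tensU /rslice lextU coefF.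
Qed.

Lemma coef_rslice p q T : coef q (rslice p T) = mcoeff (q, p) (T : {malg K[(perms * perms)%type]}).
Proof.
have lf : linear (fun T => coef q (rslice p T) : K^o).
  by move=> a X Y; rewrite rslice_linear coef_linear.
have lg : linear (fun T : HH => mcoeff (q, p) (T : {malg K[(perms * perms)%type]}) : K^o).
  by move=> a X Y; rewrite mcoeffD mcoeffZ.
apply: (lspan_eq lf lg) (FQSym2_span T) => _ [u [v ->]].
rewrite rslice_tens coefZ !coefF tensU mcoeffU xpair_eqE.
by rewrite -natrM mulnb andbC.
Qed.

Lemma rslice_eq T : (forall p, rslice p T = 0) -> T = 0.
Proof.
move=> T0; apply/malgP => -[q p]; rewrite -coef_rslice T0 mcoeff0.
exact: (lin0 (coef_linear q)).
Qed.

Definition proj n x : H := lext (fun u => (tag u == n)%:R *: F u) x.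

Lemma proj_linear n : linear (proj n). Proof. exact: lext_is_linear. Qed.

Lemma projF n u : proj n (F u) = (tag u == n)%:R *: F u.
Proof. rewrite /proj F.unlock; exact: lextU. Qed.

Lemma coef_proj n x p : coef p (proj n x) = (tag p == n)%:R * coef p x.
Proof.
apply: (lspan_eq (f := fun x => coef p (proj n x) : K^o) (g := fun x => (tag p == n)%:R * coef p x : K^o))
  (FQSym_spanF x).
- by move=> a y z; rewrite proj_linear coef_linear.
- by move=> a y z; rewrite coef_linear mulrDr !scalerAr.
move=> _ [u ->]; rewrite projF coefZ coefF /=.
by case: (eqVneq u p) => [->|_] //; rewrite !mulr0.
Qed.

Definition homog n x := forall p, coef p x != 0 -> tag p = n.

Lemma homog_proj n x : homog n (proj n x).
Proof.
by move=> p; rewrite coef_proj; case: (eqVneq (tag p) n) => // _; rewrite mul0r eqxx.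
Qed.

Lemma proj_homog n x : homog n x -> proj n x = x.
Proof.
move=> hx; apply: coef_eq => p; rewrite coef_proj.
by case: (eqVneq (coef p x) 0) => [->|/hx ->]; rewrite ?mulr0 // eqxx mul1r.
Qed.

Lemma homogP n x : proj n x = x -> homog n x.
Proof. by move=> <-; apply: homog_proj. Qed.

Lemma proj_homog_neq m n x : homog n x -> m != n -> proj m x = 0.
Proof.
move=> hx mn; apply: coef_eq => p; rewrite coef_proj coef0.
case: eqP => [e|]; last by rewrite mul0r.
case: (eqVneq (coef p x) 0) => [->|/hx pn]; first by rewrite mulr0.
by rewrite -e pn eqxx in mn.
Qed.

Lemma homogF u : homog (tag u) (F u).
Proof. by move=> p; rewrite coefF; case: (eqVneq u p) => [->//|_]; rewrite eqxx. Qed.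

Lemma homog_span n x : homog n x -> lspan (fun z : H => exists2 u, tag u = n & z = F u) x.
Proof.
move=> /proj_homog <-; apply: (lspan_map (@proj_linear n)) (FQSym_spanF x) => _ [u ->].
rewrite projF; case: eqP => [e|]; last by rewrite mulr0n scale0r => _; apply: lspan0.
by apply: lspanZ; apply: lspan_gen; exists u.
Qed.

Lemma homog_lspan n (P : H -> Prop) x : (forall z, P z -> homog n z) ->
  lspan P x -> homog n x.
Proof.
move=> hP; elim=> [p|a y z /hP hy _ hz p].
  by rewrite coef0 eqxx.
rewrite coef_linear /=; case: (eqVneq (coef p y) 0) => [->|/hy//].
by rewrite scaler0 add0r => /hz.
Qed.

Lemma homogM m n x y : homog m x -> homog n y -> homog (m + n) (x * y).
Proof.
move=> /homog_span hx /homog_span hy.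
have {hx}: lspan (fun z : H => exists u v, [/\ tag u = m, tag v = n & z = F u * F v]) (x * y).
  apply: (lspan_map (mulr_linear y)) hx => _ [u um ->].
  apply: (lspan_map (mull_linear (F u))) hy => _ [v vn ->].
  by apply: lspan_gen; exists u, v.
apply: homog_lspan => _ [u [v [um vn ->]]].
rewrite FQSym_mulFE => p; rewrite coef_sum => np.
apply/eqP; apply: contraNT np => np; rewrite big_seq big1 // => w /shuffle_permword[_ sw].
rewrite coefF; case: eqP => // e; case/eqP: np.
by rewrite -e tag_perm_of sw um vn.
Qed.

Lemma degree_bound x : exists d, lspan (fun z : H => exists2 u, (tag u < d)%N & z = F u) x.
Proof.
elim: (FQSym_spanF x) => [|a _ z [u ->] _ [d IH]]; first by exists 0%N; apply: lspan0.
exists (maxn (tag u).+1 d); apply: lspan_cons; first by exists u => //; lia.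
by apply: lspanS IH => _ [v vd ->]; exists v => //; lia.
Qed.

Lemma sum_proj d x : lspan (fun z : H => exists2 u, (tag u < d)%N & z = F u) x ->
  x = \sum_(n < d) proj n x.
Proof.
apply: (lspan_eq (f := id) (g := fun x => \sum_(n < d) proj n x)) => //.
  move=> a y z; rewrite scaler_sumr -big_split /=; apply: eq_bigr => i _.
  exact: proj_linear.
move=> _ [u ud ->]; rewrite (bigD1 (Ordinal ud)) //= projF eqxx scale1r big1 ?addr0 //.
move=> i; rewrite -val_eqE /= projF eq_sym => /negbTE ->; exact: scale0r.
Qed.

(** The counit of H. *)
Definition eps x : K := coef empty_perm x.

Lemma eps_linear : linear (eps : H -> K^o). Proof. exact: coef_linear. Qed.

Lemma eps1 : eps 1 = 1. Proof. by rewrite /eps FQSym_oneE coefF eqxx. Qed.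

Lemma epsM x y : eps (x * y) = eps x * eps y.
Proof.
apply: (lspan_eq (f := fun x => eps (x * y) : K^o) (g := fun x => eps x * eps y : K^o)) (FQSym_spanF x).
- by move=> a z t; rewrite mulr_linear eps_linear.
- by move=> a z t; rewrite eps_linear mulrDl scalerAl.
move=> _ [u ->].
apply: (lspan_eq (f := fun y => eps (F u * y) : K^o) (g := fun y => eps (F u) * eps y : K^o)) (FQSym_spanF y).
- by move=> a z t; rewrite mull_linear eps_linear.
- by move=> a z t; rewrite eps_linear mulrDr scalerAr.
move=> _ [v ->].
have := homogM (@homogF u) (@homogF v) (p := empty_perm).
rewrite tag_empty -/(eps _).
case: (eqVneq u empty_perm) => [->|nu].
  by rewrite -FQSym_oneE eps1 !mul1r.
rewrite /eps (coefF _ u) (negbTE nu) mul0r => h; apply/eqP/negPn/negP => /h e.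
by case/eqP: nu; apply: tag_eq0; lia.
Qed.

End Basics.

(** * H+ is a free left H-module *)

Fixpoint inversions (w : seq nat) : nat :=
  if w is x :: w' then (count (fun y => y < x)%N w' + inversions w')%N else 0%N.

Lemma inversions_bound w : (inversions w <= size w * size w)%N.
Proof.
elim: w => //= x w IH; have := count_size (fun y => y < x)%N w; nia.
Qed.

Lemma inversions_insert s y t : (forall x, x \in s -> x < y)%N ->
  inversions (s ++ y :: t) =
  (count (fun z => z < y)%N t + inversions (s ++ t))%N.
Proof.
elim: s => //= x s IH lts; rewrite IH => [|z zs]; last first.
  by apply: lts; rewrite inE zs orbT.
have := lts x (mem_head _ _); rewrite !count_cat /=; lia.
Qed.

(** Any shuffle other than the concatenation places some letter of t before a
    letter of s, which is smaller; this creates inversions and removes none. *)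
Lemma shuffle_head s t : (forall x y, x \in s -> y \in t -> x < y)%N ->
  exists r, shuffle s t = (s ++ t) :: r /\
    forall w, w \in r -> (inversions (s ++ t) < inversions w)%N.
Proof.
move: s t; apply: shuffle_ind => [t _ | x s _ | x s y t IH1 IH2 lt].
- by exists [::].
- by exists [::]; rewrite shuffles0 cats0.
have [|r1 [e1 H1]] := IH1; first by move=> a b aS; apply: lt; rewrite inE aS orbT.
have [|r2 [e2 H2]] := IH2; first by move=> a b aS bt; apply: lt; rewrite // inE bt orbT.
rewrite shuffle_cons e1 map_cons cat_cons; eexists; split; first by [].
move=> w; rewrite mem_cat => /orP[] /mapP[w' w'r ->{w}].
  have pw : perm_eq w' (s ++ y :: t).
    by apply: shuffle_perm; rewrite e1 inE w'r orbT.
  by rewrite /= (seq.permP pw) ltn_add2l; apply: H1.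
have pw : perm_eq w' ((x :: s) ++ t) by apply: shuffle_perm.
have le : (inversions ((x :: s) ++ t) <= inversions w')%N.
  by move: w'r; rewrite e2 inE => /orP[/eqP ->//|/H2/ltnW].
rewrite inversions_insert => [|z zs]; last by apply: lt; rewrite ?mem_head.
rewrite [X in (_ < X)%N]/= (seq.permP pw) count_cat /=.
by have := lt x y (mem_head _ _) (mem_head _ _); move: le => /=; lia.
Qed.

Lemma permword_cat s t : permword s ->
  permword (s ++ shift (size s) t) = permword t.
Proof.
move=> ps; rewrite /permword size_cat [size (shift _ _)]size_map iotaD addnC iotaDl.
have pp : perm_eq (s ++ shift (size s) t) (iota 1 (size s) ++ shift (size s) t).
  by rewrite perm_cat2r.
rewrite (permPl pp).
rewrite perm_cat2l; apply/idP/idP; last exact: perm_map.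
by apply: perm_map_inj; apply: addnI.
Qed.

Lemma size_shift n s : size (shift n s) = size s.
Proof. exact: size_map. Qed.

Definition pcat (u v : perms) : perms := perm_of (word u ++ shift (tag u) (word v)).

Lemma permword_pcat u v : permword (word u ++ shift (tag u) (word v)).
Proof. by rewrite -(size_word u) permword_cat permword_word. Qed.

Lemma word_pcat u v : word (pcat u v) = word u ++ shift (tag u) (word v).
Proof. by rewrite perm_ofK // permword_pcat. Qed.

Lemma tag_pcat u v : tag (pcat u v) = (tag u + tag v)%N.
Proof. by rewrite -size_word word_pcat size_cat size_shift !size_word. Qed.

(** The nonempty permutations that are not pcat u v with u and v nonempty: the
    free generators of H are indexed by them. *)
Definition connected (c : perms) : Prop :=
  (0 < tag c)%N /\ forall j, (0 < j < tag c)%N -> ~~ permword (take j (word c)).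

(** If u were strictly shorter than u', the part of u' beyond u would be a
    proper prefix of c that is itself a permutation. *)
Lemma pcat_inj_le u u' c c' : (tag u <= tag u')%N -> connected c -> connected c' ->
  pcat u c = pcat u' c' -> u = u' /\ c = c'.
Proof.
move=> le [c0 Hc] [c'0 _] e.
have et : (tag u + tag c = tag u' + tag c')%N by rewrite -!tag_pcat e.
have ew : word u ++ shift (tag u) (word c) = word u' ++ shift (tag u') (word c').
  by rewrite -!word_pcat e.
have eu' : word u' = word u ++ shift (tag u) (take (tag u' - tag u) (word c)).
  have := congr1 (take (tag u')) ew; rewrite (take_size_cat _ (size_word u')) => <-.
  by rewrite take_cat size_word ltnNge le /= /shift map_take.
have etag : tag u = tag u'.
  apply/eqP; rewrite eqn_leq le leqNgt; apply/negP => lt.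
  have /Hc/negP[] : (0 < tag u' - tag u < tag c)%N by lia.
  by rewrite -(permword_cat _ (permword_word u)) size_word -eu' permword_word.
have uu : u = u'.
  by apply: word_inj; rewrite eu' etag subnn take0 /= cats0.
split=> //; subst u'; apply: word_inj.
move/(congr1 (drop (tag u))): ew; rewrite !(drop_size_cat _ (size_word u)).
by apply: inj_map; apply: addnI.
Qed.

Lemma pcat_inj u u' c c' : connected c -> connected c' ->
  pcat u c = pcat u' c' -> u = u' /\ c = c'.
Proof.
move=> Cc Cc' e; case: (leqP (tag u) (tag u')) => [le|/ltnW le].
  exact: pcat_inj_le.
by have [-> ->] := pcat_inj_le le Cc' Cc (esym e).
Qed.

(** The connected factor is what remains after the longest proper prefix that
    is a permutation. *)
Lemma pcat_decomp w : (0 < tag w)%N -> exists u c, connected c /\ pcat u c = w.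
Proof.
move=> w0; pose P i := (i < tag w)%N && permword (take i (word w)).
have exP : exists i, P i by exists 0%N; rewrite /P w0 take0.
have bP i : P i -> (i <= tag w)%N by case/andP => /ltnW.
case: (ex_maxnP exP bP) => i /andP[iw pi] maxi.
have si : size (take i (word w)) = i by rewrite size_take size_word iw.
pose t := [seq (x - i)%N | x <- drop i (word w)].
have pd : perm_eq (drop i (word w)) (iota (1 + i) (tag w - i)).
  rewrite -(perm_cat2l (take i (word w))) cat_take_drop.
  have := permword_word w; rewrite /permword size_word => /perm_trans; apply.
  have {1}-> : tag w = (i + (tag w - i))%N by lia.
  rewrite iotaD perm_cat2r perm_sym; move: pi; rewrite /permword si; exact.
have et : shift i t = drop i (word w).
  rewrite /shift /t -map_comp -[RHS]map_id; apply/eq_in_map => x.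
  by rewrite (perm_mem pd) mem_iota /=; lia.
have ew : word w = take i (word w) ++ shift (size (take i (word w))) t.
  by rewrite si et cat_take_drop.
have pt : permword t by rewrite -(permword_cat _ pi) -ew permword_word.
have st : size t = (tag w - i)%N by rewrite size_map size_drop size_word.
exists (perm_of (take i (word w))), (perm_of t); split; last first.
  by apply: word_inj; rewrite word_pcat tag_perm_of !perm_ofK.
split=> [|j]; rewrite tag_perm_of st; first by lia.
move=> lej; rewrite perm_ofK //; apply/negP => pj.
have /maxi : P (i + j)%N; last by lia.
rewrite /P; apply/andP; split; first by lia.
rewrite [word w]ew take_cat si ltnNge leq_addr /= addKn.
by rewrite /shift -map_take -/(shift _ _) -{2}si permword_cat.
Qed.

Section Freeness.
Variable K : fieldType.
Local Notation H := (FQSym K).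
Local Notation HH := (FQSym2 K).

Definition pinv (u : perms) := inversions (word u).

Lemma mulF_lead u v : exists r : seq perms,
  F u * F v = F (pcat u v) + \sum_(w <- r) F w :> H /\
  forall w, w \in r -> (pinv (pcat u v) < pinv w)%N /\ tag w = (tag u + tag v)%N.
Proof.
have [|r [e Hr]] := @shuffle_head (word u) (shift (tag u) (word v)).
  by move=> x y /word_le + /mapP[z /word_le + ->]; lia.
exists (map perm_of r); split.
  by rewrite FQSym_mulFE e big_cons big_map.
move=> _ /mapP[w wr ->]; rewrite tag_perm_of.
have [|pw ->] := @shuffle_permword u v w; first by rewrite e inE wr orbT.
by split=> //; rewrite /pinv word_pcat perm_ofK // Hr.
Qed.

(** Through [mu], the free left H-module on the connected F c is realized inside
    H (x) H; the bound d controls the degree. *)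
Definition conn_tensor d (T : HH) := exists u c,
  [/\ connected c, (tag u + tag c < d)%N & T = tens (F u) (F c)].

(** Solving the triangular system of [mulF_lead], by descending induction on
    the number of inversions. *)
Lemma mu_surj_F d w : (0 < tag w < d)%N ->
  exists2 T, lspan (conn_tensor d) T & mu T = F w :> H.
Proof.
move=> /andP[w0 wd]; have [m] := ubnP (tag w * tag w - pinv w)%N.
elim: m w w0 wd => // m IH w w0 wd lem.
have [u [c [Cc ew]]] := pcat_decomp w0.
have [r [e Hr]] := mulF_lead u c.
have etag := tag_pcat u c; rewrite ew in e Hr etag.
have {Hr} [T HT eT] : exists2 T, lspan (conn_tensor d) T & mu T = \sum_(v <- r) F v :> H.
  elim: r {e} Hr => [|v r IHr] Hr.
    by exists 0; [apply: lspan0 | rewrite big_nil (lin0 (@mu_linear K))].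
  have [|T HT eT] := IHr; first by move=> v' vr; apply: Hr; rewrite inE vr orbT.
  have [lt tv] := Hr v (mem_head _ _).
  have := inversions_bound (word v); rewrite size_word -/(pinv v) => bv.
  have [||| S HS eS] := IH v; rewrite ?tv -?etag //.
    by move: bv; rewrite tv -etag; lia.
  exists (S + T); first exact: lspanD.
  by rewrite (linD (@mu_linear K)) big_cons eS eT.
exists (tens (F u) (F c) - T).
  by apply: lspanB => //; apply: lspan_gen; exists u, c; rewrite -etag.
by rewrite (linB (@mu_linear K)) mu_tens eT e addrK.
Qed.

Lemma eps0_span d (x : H) : eps x = 0 ->
  lspan (fun z : H => exists2 u, (tag u < d)%N & z = F u) x ->
  lspan (fun z : H => exists2 u, (0 < tag u < d)%N & z = F u) x.
Proof.
move=> x0 hx; rewrite -[x]subr0 -(scale0r (1 : H)) -x0.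
apply: (lspan_map (f := fun x : H => x - eps x *: (1 : H))) hx.
  move=> a y z; rewrite eps_linear scalerDl scalerBr scalerA opprD.
  by rewrite addrACA.
move=> _ [u ud ->]; rewrite /eps coefF FQSym_oneE.
case: (eqVneq u empty_perm) => [->|u0].
  by rewrite scale1r subrr; apply: lspan0.
rewrite scale0r subr0; apply: lspan_gen; exists u => //.
by rewrite ud andbT lt0n; apply: contra u0 => /eqP/tag_eq0 ->.
Qed.

Lemma mu_surj d (x : H) : eps x = 0 ->
  lspan (fun z : H => exists2 u, (tag u < d)%N & z = F u) x ->
  exists2 T, lspan (conn_tensor d) T & mu T = x.
Proof.
move=> x0 /(eps0_span x0); elim=> [|a y z [u ud ->] _ [T HT eT]].
  by exists 0; [apply: lspan0 | apply: (lin0 (@mu_linear K))].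
have [S HS eS] := mu_surj_F ud.
by exists (a *: S + T); [apply: lspanP | rewrite mu_linear eS eT].
Qed.

(** Among the pairs occurring in T, one whose concatenation has the fewest
    inversions contributes a term that no other pair can cancel. *)
Lemma mu_inj (T : HH) :
  lspan (fun S => exists u c, connected c /\ S = tens (F u) (F c)) T ->
  mu T = 0 -> T = 0.
Proof.
move=> HT eT; pose t q := mcoeff q (T : {malg K[(perms * perms)%type]}).
have supT q : t q != 0 -> connected q.2.
  rewrite /t; elim: HT => [|a x y [u [c [Cc ->]]] _ IH]; first by rewrite mcoeff0 eqxx.
  rewrite mcoeffD mcoeffZ tensU mcoeffU.
  case: (eqVneq (u, c) q) => [<- _ //|_]; rewrite mulr0 add0r; exact: IH.
pose n q := pinv (pcat q.1 q.2).
apply/eqP; apply: contraT => T0.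
have /fset0Pn[q0 q0T] : msupp (T : {malg K[(perms * perms)%type]}) != fset0.
  apply: contra T0 => /eqP e; apply/eqP/malgP => k; rewrite mcoeff0.
  by apply: mcoeff_outdom; rewrite e in_fset0.
pose P m := [exists q : msupp (T : {malg K[(perms * perms)%type]}), n (val q) == m].
have exP : exists m, P m by exists (n q0); apply/existsP; exists [` q0T]%fset.
case: (ex_minnP exP) => m /existsP[[q qT] /= /eqP qm] minm.
have tq : t q != 0 by rewrite mcoeff_neq0.
have mu_coef q' : q' \in msupp (T : {malg K[(perms * perms)%type]}) -> 
    coef (pcat q.1 q.2) (F q'.1 * F q'.2 : H) = (q' == q)%:R.
  move=> q'T.
  have [r [-> Hr]] := mulF_lead q'.1 q'.2.
  have le : (m <= n q')%N by apply: minm; apply/existsP; exists [` q'T]%fset.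
  rewrite coefD coef_sum coefF.
  rewrite big_seq big1 => [|w /Hr[lt _]].
    rewrite addr0; congr (_%:R); congr nat_of_bool; apply/eqP/eqP => [e|->//].
    have Cq' : connected q'.2 by apply: supT; rewrite mcoeff_neq0.
    have := pcat_inj Cq' (supT _ tq) e.
    by case: (q) (q') => [a b] [a' b'] /= [-> ->].
  rewrite coefF; case: (eqVneq w _) => // ew; move: lt le; rewrite ew -qm /n.
  by move=> lt le; have := leq_ltn_trans le lt; rewrite ltnn.
have : coef (pcat q.1 q.2) (mu T) = 0 by rewrite eT coef0.
rewrite /mu lextE coef_sum.
rewrite (bigD1_seq q) //= big_seq_cond big1 => [|q' /andP[q'T nq]].
  rewrite addr0 coefZ mu_coef // eqxx.
  by move/eqP; rewrite mulr1 (negbTE tq).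
by rewrite coefZ mu_coef // (negbTE nq) mulr0.
Qed.

End Freeness.

(** * Primitive elements and the coproduct *)

Section Primitives.
Variable K : fieldType.
Local Notation H := (FQSym K).
Local Notation HH := (FQSym2 K).
Implicit Types (x y z h : H) (T : HH).

Lemma primitiveE x : x \in @primitive K -> coprod x = tens x 1 + tens 1 x.
Proof. by rewrite inE => /eqP. Qed.

Lemma tag_std (w : seq nat) : tag (std w) = size w.
Proof. by rewrite /std tag_perm_of size_stdw. Qed.

Lemma coprodF_lead u : exists2 r : seq (perms * perms),
  coprod (F u : H) = tens 1 (F u) + \sum_(q <- r) tens (F q.1) (F q.2) &
  forall q, q \in r -> (0 < tag q.1)%N /\ (tag q.1 + tag q.2 = tag u)%N.
Proof.
pose g i := (std (take i (word u)), std (drop i (word u))).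
exists [seq g i | i <- iota 1 (tag u)].
  rewrite coprodU /coprodF -(big_mkord xpredT (fun i => tens (F (g i).1) (F (g i).2))).
  rewrite big_nat_recl // big_map; congr (_ + _).
    rewrite /g /= take0 drop0 FQSym_oneE; congr (tens (F _) (F _)).
    by apply: tag_eq0; rewrite tag_std.
    by apply: word_inj; rewrite word_std ?word_uniq // stdw_word.
  by rewrite /index_iota subn0 [iota 1 _](iotaDl 1 0) big_map.
move=> _ /mapP[i iu ->]; rewrite mem_iota in iu.
have le : (i <= size (word u))%N by rewrite size_word; lia.
rewrite !tag_std size_takel // size_drop size_word.
by move: le; rewrite size_word; lia.
Qed.

(** The counit axiom, on one side. *)
Lemma counitl x : lslice empty_perm (coprod x) = x.
Proof.
apply: (lspan_eq (f := fun x => lslice empty_perm (coprod x)) (g := id)) (FQSym_spanF x) => //.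
  by move=> a y z; rewrite coprod_is_linear lslice_linear.
move=> _ [u ->]; have [r -> Hr] := coprodF_lead u.
rewrite (linD (@lslice_linear _ _)) (lin_sum (@lslice_linear _ _)) lslice_tens.
rewrite -/(eps _) eps1 scale1r big_seq big1 ?addr0 // => q /Hr[q0 _].
rewrite lslice_tens coefF; case: eqVneq => [e|_]; last by rewrite scale0r.
by rewrite e tag_empty in q0.
Qed.

Lemma eps_primitive x : x \in @primitive K -> eps x = 0.
Proof.
move=> /primitiveE ex; have := counitl x.
rewrite ex (linD (@lslice_linear _ _)) !lslice_tens -/(eps _) -/(eps _) eps1 scale1r.
move/(congr1 (@eps K)); rewrite /eps coefD coefZ -/(eps _) -/(eps _) eps1 mulr1.
by move/(canRL (addrK _)); rewrite subrr.
Qed.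

Definition projT n T : HH :=
  lext (fun q : (perms * perms)%type => (tag q.1 + tag q.2 == n)%N%:R *: tens (F q.1) (F q.2)) T.

Lemma projT_linear n : linear (projT n). Proof. exact: lext_is_linear. Qed.

Lemma projTF n u v : projT n (tens (F u) (F v)) =
  (tag u + tag v == n)%N%:R *: tens (F u) (F v).
Proof. by rewrite {1}tensU /projT lextU. Qed.

Lemma coprod_proj n x : coprod (proj n x) = projT n (coprod x).
Proof.
apply: (lspan_eq (f := fun x => coprod (proj n x)) (g := fun x => projT n (coprod x)))
  (FQSym_spanF x).
- by move=> a y z; rewrite proj_linear coprod_is_linear.
- by move=> a y z; rewrite coprod_is_linear projT_linear.
move=> _ [u ->]; have [r er Hr] := coprodF_lead u.
rewrite projF (linZ (@coprod_is_linear K)) er FQSym_oneE.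
rewrite (linD (@projT_linear n)) (lin_sum (@projT_linear n)) projTF scalerDr tag_empty.
rewrite add0n; congr (_ + _); rewrite scaler_sumr big_seq [RHS]big_seq.
by apply: eq_bigr => q /Hr[_ e]; rewrite projTF e.
Qed.

Lemma projT_tens1 n x : projT n (tens x 1) = tens (proj n x) 1.
Proof.
apply: (lspan_eq (f := fun x => projT n (tens x 1)) (g := fun x => tens (proj n x) 1))
  (FQSym_spanF x).
- by move=> a y z; rewrite tensPl projT_linear.
- by move=> a y z; rewrite proj_linear tensPl.
move=> _ [u ->]; rewrite FQSym_oneE projTF projF tag_empty addn0.
by rewrite (linZ (@tensl_linear _ _)).
Qed.

Lemma projT_1tens n x : projT n (tens 1 x) = tens 1 (proj n x).
Proof.
apply: (lspan_eq (f := fun x => projT n (tens 1 x)) (g := fun x => tens 1 (proj n x)))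
  (FQSym_spanF x).
- by move=> a y z; rewrite tensPr projT_linear.
- by move=> a y z; rewrite proj_linear tensPr.
move=> _ [u ->]; rewrite FQSym_oneE projTF projF tag_empty add0n.
by rewrite (linZ (@tensr_linear _ _)).
Qed.

Lemma primitive_proj n x : x \in @primitive K -> proj n x \in @primitive K.
Proof.
move=> /primitiveE ex; rewrite inE coprod_proj ex (linD (@projT_linear n)).
by rewrite projT_tens1 projT_1tens.
Qed.

Definition hprim n x := [/\ (0 < n)%N, homog n x & x \in @primitive K].

(** The coproduct is homogeneous, so the Lie algebra of primitive elements is
    graded. *)
Lemma hprim_proj n x : (0 < n)%N -> x \in @primitive K -> hprim n (proj n x).
Proof. by split=> //; [apply: homog_proj | apply: primitive_proj]. Qed.

Lemma hprim_span x : x \in @primitive K -> lspan (fun z => exists n, hprim n z) x.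
Proof.
move=> px; have [d /sum_proj ->] := degree_bound x.
apply: lspan_sum => -[[|n] nd] _ /=; last first.
  by apply: lspan_gen; exists n.+1; apply: hprim_proj.
have -> : proj 0 x = 0; last exact: lspan0.
apply: coef_eq => p; rewrite coef_proj coef0; case: eqVneq => [/tag_eq0 ->|_].
  by rewrite -/(eps _) eps_primitive // mulr0.
by rewrite mul0r.
Qed.

Lemma hprimB n x y : hprim n x -> hprim n y -> hprim n (x - y).
Proof.
move=> [n0 hx px] [_ hy py]; split=> //; last exact: rpredB.
by apply: homogP; rewrite (linB (@proj_linear _ n)) !proj_homog.
Qed.

Lemma hprimD n x y : hprim n x -> hprim n y -> hprim n (x + y).
Proof.
move=> [n0 hx px] [_ hy py]; split=> //; last exact: rpredD.
by apply: homogP; rewrite (linD (@proj_linear _ n)) !proj_homog.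
Qed.

Lemma hprimZ n a x : hprim n x -> hprim n (a *: x).
Proof.
move=> [n0 hx px]; split=> //; last exact: rpredZ.
by apply: homogP; rewrite (linZ (@proj_linear _ n)) proj_homog.
Qed.

(** Generators of the right ideal g H, of its component of degree n, and of the
    subspace g H+. *)
Definition J z := exists m x v, hprim m x /\ z = x * F v.
Definition Jdeg n z := exists m x v,
  [/\ hprim m x, (m + tag v = n)%N & z = x * F v].
Definition Jplus z := exists m x v, [/\ hprim m x, (0 < tag v)%N & z = x * F v].

Lemma J_mulr x y : lspan J x -> lspan J (x * y).
Proof.
apply: (lspan_map (@mulr_linear _ y)) => _ [m [z [v [hz ->]]]].
rewrite -mulrA; apply: (lspan_map (@mull_linear _ z)) (FQSym_spanF (F v * y)) => _ [w ->].
by apply: lspan_gen; exists m, z, w.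
Qed.

Lemma primitive_J x : x \in @primitive K -> lspan J x.
Proof.
move=> /hprim_span; apply: lspanS => z [m hz].
by exists m, z, empty_perm; rewrite -FQSym_oneE mulr1.
Qed.

Lemma proj_mulF n m x v : homog m x ->
  proj n (x * F v) = (m + tag v == n)%N%:R *: (x * F v).
Proof.
move=> hx; have hxv := homogM hx (@homogF K v).
case: eqVneq => [<-|ne]; first by rewrite proj_homog // scale1r.
by rewrite (proj_homog_neq hxv) ?scale0r // eq_sym.
Qed.

Lemma proj_J n z : lspan J z -> lspan (Jdeg n) (proj n z).
Proof.
apply: (lspan_map (@proj_linear _ n)) => _ [m [x [v [hx ->]]]].
have [_ hh _] := hx; rewrite (proj_mulF _ _ hh).
case: eqVneq => [e|_]; last by rewrite scale0r; apply: lspan0.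
by apply: lspanZ; apply: lspan_gen; exists m, x, v.
Qed.

Lemma proj_Jplus n z : lspan Jplus z -> lspan Jplus (proj n z).
Proof.
apply: (lspan_map (@proj_linear _ n)) => _ [m [x [v [hx v0 ->]]]].
have [_ hh _] := hx; rewrite (proj_mulF _ _ hh).
by apply: lspanZ; apply: lspan_gen; exists m, x, v.
Qed.

(** Generators of H (x) g H, modulo which coproducts are computed below. *)
Definition HJ T := exists a j, lspan J j /\ T = tens a j.

Lemma HJ_slice p T : lspan HJ T -> lspan J (lslice p T).
Proof.
apply: (lspan_map (@lslice_linear _ p)) => _ [a [j [Jj ->]]].
by rewrite lslice_tens; apply: lspanZ.
Qed.

Lemma HJ_mull x T : lspan HJ T -> lspan HJ (tens_mul (tens x 1) T).
Proof.
apply: (lspan_map (@tens_mull_linear _ _)) => _ [a [j [Jj ->]]].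
by apply: lspan_gen; exists (x * a), j; rewrite tens_mulE mul1r.
Qed.

Lemma HJ_prim x T : x \in @primitive K -> lspan HJ (tens_mul (tens 1 x) T).
Proof.
move=> px; apply: (lspan_map (@tens_mull_linear _ _)) (FQSym2_span T) => _ [u [v ->]].
apply: lspan_gen; exists (F u), (x * F v); rewrite tens_mulE mul1r.
by split=> //; apply: J_mulr; apply: primitive_J.
Qed.

Inductive hmon : nat -> nat -> H -> Prop :=
| hmon1 n x : hprim n x -> hmon 1 n x
| hmonS m x k n y : hprim m x -> hmon k n y -> hmon k.+1 (m + n) (x * y).

Lemma hmon_homog k n u : hmon k n u -> homog n u.
Proof.
elim=> [{}n x [] //|m x {}k {}n y [_ hx _] _ hy]; exact: homogM.
Qed.

Lemma hmon_gt0 k n u : hmon k n u -> (0 < k)%N.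
Proof. by case. Qed.

Lemma hmon_rcons k n u m x : hmon k n u -> hprim m x -> hmon k.+1 (n + m) (u * x).
Proof.
move=> hu hx; elim: hu => [{}n y hy|m' y {}k {}n u' hy _ IH].
  by apply: hmonS => //; apply: hmon1.
by rewrite -mulrA -addnA; apply: hmonS.
Qed.

(** Generators of the augmentation ideal U+ of the subalgebra generated by the
    primitive elements, and of its square. *)
Definition Uone z := exists k n, hmon k n z.
Definition Utwo z := exists k n, (1 < k)%N /\ hmon k n z.

Lemma Utwo_Uone z : lspan Utwo z -> lspan Uone z.
Proof. by apply: lspanS => x [k [n [_ hx]]]; exists k, n. Qed.

Lemma Uone_mulr u m x : lspan Uone u -> hprim m x -> lspan Utwo (u * x).
Proof.
move=> Uu hx; apply: (lspan_map (@mulr_linear _ x)) Uu => y [k [n hy]].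
apply: lspan_gen; exists k.+1, (n + m)%N; split; last exact: hmon_rcons.
by rewrite ltnS (hmon_gt0 hy).
Qed.

Lemma tens_mul1A x y T :
  tens_mul (tens (x * y) 1) T = tens_mul (tens x 1) (tens_mul (tens y 1) T).
Proof.
apply: (lspan_eq (f := tens_mul (tens (x * y) 1))
  (g := fun T => tens_mul (tens x 1) (tens_mul (tens y 1) T))) (FQSym2_span T).
- exact: tens_mull_linear.
- by move=> a S S'; rewrite !tens_mulPr.
by move=> _ [u [v ->]]; rewrite !tens_mulE !mul1r mulrA.
Qed.

Lemma tens_mul_primitive x T : x \in @primitive K ->
  tens_mul (coprod x) T = tens_mul (tens x 1) T + tens_mul (tens 1 x) T.
Proof.
move=> /primitiveE ->; have := tens_mulPl 1 (tens x 1) (tens 1 x) T.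
by rewrite !scale1r.
Qed.

(** The coproduct of a primitive x is x (x) 1 + 1 (x) x, and multiplication on
    the left by 1 (x) x lands in H (x) g H. *)
Lemma hmon_coprod k n u h : hmon k n u ->
  lspan HJ (coprod (u * h) - tens_mul (tens u 1) (coprod h)).
Proof.
elim=> [{}n x [_ _ px]|m x {}k {}n y [_ _ px] _ IH].
  rewrite coprodM tens_mul_primitive // addrC addrA addNr add0r.
  exact: HJ_prim.
rewrite -mulrA coprodM tens_mul_primitive // tens_mul1A addrAC.
rewrite -(linB (@tens_mull_linear _ _)).
by apply: lspanD; [apply: HJ_mull | apply: HJ_prim].
Qed.

Lemma Uone_coprod u h : lspan Uone u ->
  lspan HJ (coprod (u * h) - tens_mul (tens u 1) (coprod h)).
Proof.
apply: (lspan_map (f := fun u => coprod (u * h) - tens_mul (tens u 1) (coprod h))).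
  move=> a x y; rewrite mulr_linear coprod_is_linear tensPl tens_mulPl.
  by rewrite scalerBr opprD addrACA.
by move=> x [k [n hx]]; apply: hmon_coprod hx.
Qed.

(** Only the term 1 (x) h of the coproduct of h has a right-hand factor of
    degree as high as that of h. *)
Lemma proj_slice_coprod d p u h :
  lspan (fun z : H => exists2 v, (tag v < d.+1)%N & z = F v) h ->
  proj d (lslice p (tens_mul (tens u 1) (coprod h))) = coef p u *: proj d h.
Proof.
apply: (lspan_eq (f := fun h => proj d (lslice p (tens_mul (tens u 1) (coprod h))))
  (g := fun h => coef p u *: proj d h)).
- by move=> a x y; rewrite coprod_is_linear tens_mulPr lslice_linear proj_linear.
- by move=> a x y; rewrite proj_linear scalerDr !scalerA mulrC.
move=> _ [v vd ->]; have [r -> Hr] := coprodF_lead v.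
rewrite (linD (@tens_mull_linear _ _)) (lin_sum (@tens_mull_linear _ _)).
rewrite (linD (@lslice_linear _ _)) (lin_sum (@lslice_linear _ _)).
rewrite (linD (@proj_linear _ _)) (lin_sum (@proj_linear _ _)).
rewrite tens_mulE mulr1 mul1r lslice_tens (linZ (@proj_linear _ _)).
rewrite big_seq big1 ?addr0 // => q /Hr[q0 eq].
rewrite tens_mulE mul1r lslice_tens (linZ (@proj_linear _ _)) projF.
have /negbTE -> : tag q.2 != d by apply/eqP; lia.
by rewrite scale0r scaler0.
Qed.

Lemma slice_Uone d p u h : lspan Uone u ->
  lspan (fun z : H => exists2 v, (tag v < d.+1)%N & z = F v) h ->
  lspan (Jdeg d) (proj d (lslice p (coprod (u * h))) - coef p u *: proj d h).
Proof.
move=> Uu hh; rewrite -(proj_slice_coprod p u hh) -(linB (@proj_linear _ _)).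
rewrite -(linB (@lslice_linear _ _)); apply: proj_J; apply: HJ_slice.
exact: Uone_coprod.
Qed.

Lemma lspan_tens_seq (P : H -> Prop) (Q : H -> Prop) T :
  lspan (fun S => exists u h, [/\ lspan P u, Q h & S = tens u h]) T ->
  exists2 s : seq (H * H), (forall r, r \in s -> lspan P r.1) &
    T = \sum_(r <- s) tens r.1 r.2.
Proof.
elim=> [|a _ T' [u [h [Pu _ ->]]] _ [s Ps ->]]; first by exists [::]; rewrite ?big_nil.
exists ((a *: u, h) :: s).
  by move=> r; rewrite inE => /orP[/eqP ->|/Ps //]; apply: lspanZ.
by rewrite big_cons (linZ (@tensl_linear _ _)).
Qed.

(** (A (x) H) meets (H (x) B) in A (x) B, for subspaces A and B of H: Gaussian
    elimination on the left-hand factors, a nonzero coordinate p of u being used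
    as a pivot to express h by the other right-hand factors modulo B. *)
Lemma tensor_elim (P G : H -> Prop) (s : seq (H * H)) :
  (forall r, r \in s -> lspan P r.1) ->
  (forall p, lspan G (lslice p (\sum_(r <- s) tens r.1 r.2))) ->
  lspan (fun S => exists u j, [/\ lspan P u, lspan G j & S = tens u j])
    (\sum_(r <- s) tens r.1 r.2).
Proof.
have [m] := ubnP (size s); elim: m s => // m IH [|[u h] s] /=.
  by move=> _ _ _; rewrite big_nil; apply: lspan0.
move=> sm Ps Gs.
have Pu : lspan P u by apply: (Ps (u, h)); rewrite mem_head.
have Ps' r : r \in s -> lspan P r.1 by move=> rs; apply: Ps; rewrite inE rs orbT.
case: (eqVneq u 0) => [u0|].
  move: Gs; rewrite big_cons /= u0 tens0l add0r => Gs; exact: IH.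
move=> /coef_neq0[p cp]; pose c := coef p u.
pose s' := [seq (r.1 - (coef p r.1 / c) *: u, r.2) | r <- s].
(* the slice at the pivot p of the hypothesis, solved for h *)
have [j Gj ej] : exists2 j, lspan G j &
    h = j - \sum_(r <- s) (coef p r.1 / c) *: r.2.
  exists (c^-1 *: lslice p (\sum_(r <- (u, h) :: s) tens r.1 r.2)).
    exact: lspanZ.
  rewrite big_cons (linD (@lslice_linear _ _)) (lin_sum (@lslice_linear _ _)).
  rewrite lslice_tens scalerDr scalerA mulVf // scale1r scaler_sumr -addrA.
  rewrite -[LHS]addr0 -sumrB big1 // => r _.
  by rewrite lslice_tens scalerA mulrC subrr.
have es : \sum_(r <- (u, h) :: s) tens r.1 r.2 =
    tens u j + \sum_(r <- s') tens r.1 r.2.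
  rewrite big_cons big_map /= {1}ej (linB (@tensr_linear _ _)) -addrA; congr (_ + _).
  rewrite (lin_sum (@tensr_linear _ _)) addrC -sumrB; apply: eq_bigr => r _ /=.
  by rewrite (linB (@tensl_linear _ _)) (linZ (@tensl_linear _ _)) (linZ (@tensr_linear _ _)).
rewrite es; apply: lspanD; first by apply: lspan_gen; exists u, j.
apply: IH => [|_ /mapP[r rs ->]|q] /=.
- by rewrite size_map.
- by apply: lspanB; [apply: Ps' | apply: lspanZ].
have -> : \sum_(r <- s') tens r.1 r.2 =
    \sum_(r <- (u, h) :: s) tens r.1 r.2 - tens u j.
  by rewrite es addrC addrA addNr add0r.
rewrite (linB (@lslice_linear _ _)) lslice_tens.
by apply: lspanB => //; apply: lspanZ.
Qed.

End Primitives.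

(** * Primitive elements of g H+ are decomposable *)

Section Decomposable.
Variable K : fieldType.
Local Notation H := (FQSym K).
Local Notation HH := (FQSym2 K).
Implicit Types (x y z h : H) (T : HH).

(** Generators of U+ (x) H+ with right-hand degree at most d. *)
Definition UHplus d T := exists u v,
  [/\ lspan (@Uone K) u, (0 < tag v <= d)%N & T = tens u (F v)].

Lemma slice_UHplus d p T : lspan (UHplus d) T ->
  lspan (@Jdeg K d) (proj d (lslice p (coprod (mu T))) - proj d (lslice p T)).
Proof.
apply: (lspan_map (f := fun T =>
  proj d (lslice p (coprod (mu T))) - proj d (lslice p T))).
  move=> a x y; rewrite mu_linear coprod_is_linear !lslice_linear !proj_linear.
  by rewrite scalerBr opprD addrACA.
move=> _ [u [v [Uu /andP[_ vd] ->]]]; rewrite mu_tens lslice_tens.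
rewrite (linZ (@proj_linear _ _)); apply: slice_Uone => //.
by apply: lspan_gen; exists v.
Qed.

Lemma UHplus_split d T : lspan (UHplus d.+1) T -> exists T1 T2,
  [/\ lspan (fun S => exists u v,
        [/\ lspan (@Uone K) u, tag v = d.+1 & S = tens u (F v)]) T1,
      lspan (UHplus d) T2 & T = T1 + T2].
Proof.
elim=> [|a x y [u [v [Uu vd ->]]] _ [T1 [T2 [H1 H2 ->]]]].
  by exists 0, 0; split; [apply: lspan0 | apply: lspan0 | rewrite addr0].
case: (eqVneq (tag v) d.+1) => [e|ne].
  exists (a *: tens u (F v) + T1), T2; rewrite addrA; split=> //.
  by apply: lspan_cons => //; exists u, v.
exists T1, (a *: tens u (F v) + T2); rewrite addrCA; split=> //.
by apply: lspan_cons => //; exists u, v; split=> //; lia.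
Qed.

(** Elements of (U+)^2 + U+ H+, with degree at most d for the factor in H+; the
    aim is to lower d to 0. *)
Definition reduced d z := exists q T,
  [/\ lspan (@Utwo K) q, lspan (UHplus d) T & z = q + mu T].

Lemma reduced_lspan d z : lspan (reduced d) z -> reduced d z.
Proof.
elim=> [|a x y [q [T [Hq HT ->]]] _ [q' [T' [Hq' HT' ->]]]].
  exists 0, 0; split; [exact: lspan0 | exact: lspan0 |].
  by rewrite add0r (lin0 (@mu_linear K)).
exists (a *: q + q'), (a *: T + T'); split; [exact: lspanP | exact: lspanP |].
by rewrite mu_linear scalerDr addrACA.
Qed.

(** With j a sum of terms x * F v with x primitive, moving x to the left-hand
    factor lowers the degree of the right-hand one. *)
Lemma Uone_Jdeg d u j : lspan (@Uone K) u -> lspan (@Jdeg K d.+1) j ->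
  reduced d (u * j).
Proof.
move=> Uu Jj; apply: reduced_lspan.
apply: (lspan_map (@mull_linear _ u)) Jj => _ [m [x [v [hx md ->]]]].
have Ux := Uone_mulr Uu hx; rewrite mulrA; apply: lspan_gen.
have [v0|v0] := posnP (tag v).
  exists (u * x), 0; split=> //; first exact: lspan0.
  by rewrite (lin0 (@mu_linear K)) addr0 (tag_eq0 v0) -FQSym_oneE mulr1.
exists 0, (tens (u * x) (F v)); split; first exact: lspan0.
  apply: lspan_gen; exists (u * x), v; split=> //; first exact: Utwo_Uone.
  by have [m0 _ _] := hx; lia.
by rewrite add0r mu_tens.
Qed.

(** Let w = q + mu T.  Modulo H (x) g H, the part of top degree of the
    right-hand factor of the coproduct of w - q is zero since w - q is in U,
    and it is the top part T1 of T since w - q = mu T.  So T1 belongs to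
    U+ (x) g H, and [Uone_Jdeg] lowers its degree. *)
Lemma reduced_Utwo d w : lspan (@Uone K) w -> reduced d w -> lspan (@Utwo K) w.
Proof.
move=> Uw; elim: d => [|d IH] [q [T [Hq HT ew]]].
  rewrite ew; apply: lspanD => //.
  apply: (lspan_map (@mu_linear K)) HT => _ [u [v [_ v0 ->]]].
  by lia.
have [T1 [T2 [H1 H2 eT]]] := UHplus_split HT.
suff [q' [T' [Hq' HT' e1]]] : reduced d (mu T1).
  apply: IH; exists (q + q'), (T' + T2); split; [exact: lspanD | exact: lspanD |].
  by rewrite ew eT !(linD (@mu_linear K)) e1 !addrA.
(* these slices are the top parts of those of T, see [slice_UHplus] *)
have sl1 p : lspan (@Jdeg K d.+1) (lslice p T1).
  have -> : lslice p T1 = proj d.+1 (lslice p T).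
    rewrite eT (linD (@lslice_linear _ _)) (linD (@proj_linear _ _)).
    rewrite [X in _ = _ + X](_ : _ = 0); last first.
      apply: (lspan_eq (f := fun T => proj d.+1 (lslice p T)) (g := fun => 0 : H)) H2.
      - by move=> a x y; rewrite lslice_linear proj_linear.
      - by move=> a x y; rewrite scaler0 addr0.
      move=> _ [u [v [_ vd ->]]]; rewrite lslice_tens (linZ (@proj_linear _ _)) projF.
      have /negbTE -> : tag v != d.+1 by apply/eqP; lia.
      by rewrite scale0r scaler0.
    rewrite addr0.
    apply: (lspan_eq (f := lslice p) (g := fun T => proj d.+1 (lslice p T))) H1.
    - exact: lslice_linear.
    - by move=> a x y; rewrite lslice_linear proj_linear.
    move=> _ [u [v [_ vd ->]]]; rewrite lslice_tens (linZ (@proj_linear _ _)).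
    by rewrite projF vd eqxx scale1r.
  have := slice_UHplus p HT.
  have -> : mu T = w - q by rewrite ew addrC addKr.
  have Uwq : lspan (@Uone K) (w - q) by apply: lspanB => //; apply: Utwo_Uone.
  have : lspan (@Jdeg K d.+1) (proj d.+1 (lslice p (coprod ((w - q) * 1)))
      - coef p (w - q) *: proj d.+1 1).
    apply: slice_Uone => //; apply: lspan_gen; exists empty_perm => //.
  have -> : proj d.+1 (1 : H) = 0 by rewrite FQSym_oneE projF tag_empty scale0r.
  rewrite mulr1 scaler0 subr0 => A B.
  by have := lspanB A B; rewrite opprB addrC subrK.
have [s Us es] : exists2 s : seq (H * H), (forall r, r \in s -> lspan (@Uone K) r.1) &
    T1 = \sum_(r <- s) tens r.1 r.2.
  apply: (@lspan_tens_seq _ _ (fun h => exists v, h = F v)).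
  apply: lspanS H1 => _ [u [v [Uu _ ->]]]; exists u, (F v); split=> //.
  by exists v.
have : lspan (fun S => exists u j, [/\ lspan (@Uone K) u, lspan (@Jdeg K d.+1) j & S = tens u j]) T1.
  by rewrite es; apply: tensor_elim => // p; rewrite -es.
move=> H1'; apply: reduced_lspan; apply: (lspan_map (@mu_linear K)) H1'.
move=> _ [u [j [Uu Jj ->]]]; rewrite mu_tens; apply: lspan_gen; exact: Uone_Jdeg.
Qed.

Lemma Jplus_reduced w : lspan (@Jplus K) w -> exists d, reduced d w.
Proof.
elim=> [|a _ y [m [x [v [hx v0 ->]]]] _ [d [q [T [Hq HT ->]]]]].
  by exists 0%N; apply: reduced_lspan; apply: lspan0.
exists (maxn d (tag v)); exists q, (a *: tens x (F v) + T); split=> //.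
  apply: lspan_cons.
    exists x, v; split=> //; last by lia.
    by apply: lspan_gen; exists 1%N, m; apply: hmon1.
  apply: lspanS HT => _ [u [v' [Uu v'd ->]]]; exists u, v'; split=> //; lia.
by rewrite mu_linear mu_tens addrCA.
Qed.

Theorem Jplus_decomposable n w : hprim n w -> lspan (@Jplus K) w ->
  lspan (fun z => exists k, (1 < k)%N /\ hmon k n z) w.
Proof.
move=> hw /Jplus_reduced[d rw]; have [n0 hh _] := hw.
have Uw : lspan (@Uone K) w by apply: lspan_gen; exists 1%N, n; apply: hmon1.
rewrite -(proj_homog hh).
apply: (lspan_map (@proj_linear K n)) (reduced_Utwo Uw rw) => z [k [m [k1 hz]]].
case: (eqVneq n m) => [->|nm].
  by rewrite (proj_homog (hmon_homog hz)); apply: lspan_gen; exists k.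
rewrite (proj_homog_neq (hmon_homog hz) nm); exact: lspan0.
Qed.

End Decomposable.

(** * Generators free over H *)

Lemma seq_argmax (T : eqType) (f : T -> nat) x0 (s : seq T) : x0 \in s ->
  exists2 x, x \in s & forall y, y \in s -> (f y <= f x)%N.
Proof.
elim: s x0 => // a s IH x0 _.
case: s IH => [_|b s IH].
  by exists a => [|y]; rewrite inE // => /eqP ->.
have [x xs Hx] := IH b (mem_head _ _).
case: (leqP (f a) (f x)) => le.
  exists x => [|y]; first by rewrite inE xs orbT.
  by rewrite inE => /orP[/eqP ->|/Hx].
exists a => [|y]; first by rewrite mem_head.
by rewrite inE => /orP[/eqP ->//|/Hx]; lia.
Qed.

(** Any enumeration of permutations serves to define leading coordinates. *)
Definition code (u : perms) : nat := choice.pickle (u : {n : nat & 'S_n}).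

Lemma code_inj : injective code.
Proof. exact: (pcan_inj (@choice.pickleK _)). Qed.

Section Generators.
Variable K : fieldType.
Local Notation H := (FQSym K).
Local Notation HH := (FQSym2 K).
Implicit Types (z w : H) (p q : perms).

Definition lead p z := coef p z = 1 /\ forall q, coef q z != 0 -> (code q <= code p)%N.

(** The leading coordinates of the homogeneous primitive elements that are not
    those of homogeneous primitive elements of g H+: by echelon reduction,
    picking one primitive element for each of them gives a basis of g modulo
    the elements of g H+. *)
Definition is_gen_index p :=
  (exists z, hprim (tag p) z /\ lead p z) /\
  ~ (exists z, [/\ hprim (tag p) z, lead p z & lspan (@Jplus K) z]).

Definition gen_index : Type := {p : perms | `[< is_gen_index p >]}.
HB.instance Definition _ := Choice.on gen_index.

Lemma gen_index_ex (x : gen_index) : exists z, hprim (tag (val x)) z /\ lead (val x) z.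
Proof. by have /asboolP[] := valP x. Qed.

Definition gen (x : gen_index) : H := projT1 (cid (gen_index_ex x)).

Lemma gen_hprim x : hprim (tag (val x)) (gen x).
Proof. by have [] := projT2 (cid (gen_index_ex x)). Qed.

Lemma gen_lead x : lead (val x) (gen x).
Proof. by have [] := projT2 (cid (gen_index_ex x)). Qed.

Lemma gen_primitive x : gen x \in @primitive K.
Proof. by have [] := gen_hprim x. Qed.

(** The homogeneous component of a combination in g H+ that contains its largest
    leading coordinate would contradict the choice of that index. *)
Lemma gen_indep (r : seq gen_index) (c : gen_index -> K) : uniq r ->
  lspan (@Jplus K) (\sum_(x <- r) c x *: gen x) -> forall x, x \in r -> c x = 0.
Proof.
move=> Ur Jz x xr; apply/eqP; apply: contraT => cx.
have [|y] := @seq_argmax _ (fun x => code (val x)) x [seq x <- r | c x != 0].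
  by rewrite mem_filter cx.
rewrite mem_filter => /andP[cy yr] ymax.
set z := \sum_(x <- r) _ in Jz; set n := tag (val y).
have cz q : (code (val y) <= code q)%N -> q != val y -> coef q z = 0.
  move=> leq nq; rewrite /z coef_sum big_seq big1 // => x' x'r; rewrite coefZ.
  case: (eqVneq (c x') 0) => [->|cx']; first by rewrite mul0r.
  apply/eqP; rewrite mulf_eq0 (negbTE cx') /=; apply: contraT => q0.
  have [_ /(_ _ q0) le1] := gen_lead x'.
  have le2 : (code (val x') <= code (val y))%N by apply: ymax; rewrite mem_filter cx'.
  by case/eqP: nq; apply: code_inj; apply/eqP; rewrite eqn_leq leq (leq_trans le1 le2).
have czy : coef (val y) z = c y.
  rewrite /z coef_sum (bigD1_seq y) //= coefZ (gen_lead y).1 mulr1.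
  rewrite big_seq_cond big1 ?addr0 // => x' /andP[x'r nx']; rewrite coefZ.
  case: (eqVneq (c x') 0) => [->|cx']; first by rewrite mul0r.
  apply/eqP; rewrite mulf_eq0 (negbTE cx') /=; apply: contraT => q0.
  have [_ /(_ _ q0) le1] := gen_lead x'.
  have le2 : (code (val x') <= code (val y))%N by apply: ymax; rewrite mem_filter cx'.
  by case/eqP: nx'; apply: val_inj; apply: code_inj; apply/eqP; rewrite eqn_leq le1 le2.
have /asboolP[_ []] := valP y; exists ((c y)^-1 *: proj n z); split.
- apply: hprimZ; apply: hprim_proj; first by have [] := gen_hprim y.
  by apply: rpred_sum => x' _; apply: rpredZ; apply: gen_primitive.
- split=> [|q]; first by rewrite coefZ coef_proj eqxx mul1r czy mulVf.
  rewrite coefZ coef_proj; apply: contraR; rewrite -ltnNge => lt.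
  rewrite cz ?mulr0 //; first exact: ltnW.
  by apply: contraTneq lt => ->; rewrite ltnn.
by apply: lspanZ; apply: proj_Jplus.
Qed.

(** Echelon reduction, by induction on a bound for the codes of the coordinates
    of z. *)
Lemma gen_span n z : hprim n z -> exists y w,
  [/\ lspan (fun y => exists x, y = gen x) y, hprim n w, lspan (@Jplus K) w & z = y + w].
Proof.
move=> hz; have [N] : exists N, forall q, coef q z != 0 -> (code q < N)%N.
  elim: (FQSym_spanF z) => [|a _ y [u ->] _ [N IH]].
    by exists 0%N => q; rewrite coef0 eqxx.
  exists (maxn (code u).+1 N) => q; rewrite coefD coefZ coefF.
  case: (eqVneq u q) => [-> _|_]; first by rewrite leq_max leqnn.
  by rewrite mulr0 add0r => /IH lt; rewrite leq_max lt orbT.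
elim: N z hz => [|N IH] z hz supz.
  exists 0, z; split; rewrite ?add0r //; first exact: lspan0.
  suff -> : z = 0 by apply: lspan0.
  by apply/eqP; apply: contraT => /coef_neq0[q /supz].
case: (pselect (exists q, coef q z != 0 /\ code q = N)) => [[q [cq codeq]]|no]; last first.
  apply: IH => // q cq; have := supz q cq; rewrite ltnS leq_eqVlt => /orP[/eqP e|//].
  by case: no; exists q.
have tq : tag q = n by have [_ hh _] := hz; apply: hh.
have [v [hv lv Hv]] : exists v, [/\ hprim n v, lead q v &
    lspan (@Jplus K) v \/ lspan (fun y => exists x, y = gen x) v].
  case: (pselect (is_gen_index q)) => [iq|].
    pose x : gen_index := exist _ q (asboolT iq).
    exists (gen x); split; last by right; apply: lspan_gen; exists x.
      by rewrite -tq; apply: (gen_hprim x).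
    exact: (gen_lead x).
  rewrite /is_gen_index => /not_andP[[]|/contrapT[v [hv lv Jv]]].
    exists ((coef q z)^-1 *: z); split; first by rewrite tq; apply: hprimZ.
    split=> [|q']; first by rewrite coefZ mulVf.
    rewrite coefZ mulf_eq0 negb_or => /andP[_ /supz].
    by rewrite codeq.
  by exists v; split; [rewrite -tq | | left].
have [|q'|y [w [Hy hw Jw e]]] := IH (z - coef q z *: v).
- by apply: hprimB => //; apply: hprimZ.
- rewrite coefB coefZ => nz.
  have q'q : q' != q.
    by apply: contraNneq nz => ->; rewrite lv.1 mulr1 subrr.
  have nN : code q' != N by apply: contraNneq q'q => eN; apply/eqP/code_inj; rewrite eN.
  rewrite ltn_neqAle nN /=.
  case: (eqVneq (coef q' z) 0) nz => [->|/supz //].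
  rewrite sub0r oppr_eq0 mulf_eq0 negb_or => /andP[_ /lv.2]; by rewrite codeq.
have ez : z = y + w + coef q z *: v by rewrite -e subrK.
case: Hv => Hv.
  exists y, (w + coef q z *: v); rewrite addrA; split=> //.
    by apply: hprimD => //; apply: hprimZ.
  by apply: lspanD => //; apply: lspanZ.
exists (y + coef q z *: v), w; split=> //; last by rewrite addrAC.
by apply: lspanD => //; apply: lspanZ.
Qed.

Lemma Jplus_mul m x (b : H) : hprim m x -> eps b = 0 -> lspan (@Jplus K) (x * b).
Proof.
move=> hx b0; have [d /(eps0_span b0)] := degree_bound b.
apply: (lspan_map (@mull_linear _ x)) => _ [v /andP[v0 _] ->].
by apply: lspan_gen; exists m, x, v.
Qed.

Lemma mu_mull (x : H) T : mu (tens_mul (tens x 1) T) = x * mu T.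
Proof.
apply: (lspan_eq (f := fun T => mu (tens_mul (tens x 1) T)) (g := fun T => x * mu T))
  (FQSym2_span T).
- by move=> a S S'; rewrite tens_mulPr mu_linear.
- by move=> a S S'; rewrite mu_linear mull_linear.
by move=> _ [u [v ->]]; rewrite tens_mulE !mu_tens mul1r mulrA.
Qed.

Lemma rslice_mull p (x : H) T : rslice p (tens_mul (tens x 1) T) = x * rslice p T.
Proof.
apply: (lspan_eq (f := fun T => rslice p (tens_mul (tens x 1) T))
  (g := fun T => x * rslice p T)) (FQSym2_span T).
- by move=> a S S'; rewrite tens_mulPr rslice_linear.
- by move=> a S S'; rewrite rslice_linear mull_linear.
by move=> _ [u [v ->]]; rewrite tens_mulE !rslice_tens mul1r scalerAr.
Qed.

(** The weak algorithm.  The constant terms of the coefficients a x give a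
    combination of the gen x in g H+, hence vanish by [gen_indep]; then
    a x = mu (A x) and uniqueness of such an expression turns the relation into
    one for each connected p, between the coefficients rslice p (A x), whose
    degrees are smaller. *)
Lemma gen_right_indep (r : seq gen_index) (a : gen_index -> H) : uniq r ->
  \sum_(x <- r) gen x * a x = 0 -> forall x, x \in r -> a x = 0.
Proof.
move=> Ur; have [d] : exists d, forall x, x \in r ->
    lspan (fun z : H => exists2 u, (tag u < d)%N & z = F u) (a x).
  elim: r {Ur} => [|y r [d IH]]; first by exists 0%N.
  have [e He] := degree_bound (a y); exists (maxn d e) => x.
  rewrite inE => /orP[/eqP ->|/IH]; [move: He|]; apply: lspanS => _ [u lt ->];
    by exists u => //; lia.
elim: d a => [|d IH] a.
  by move=> a0 _ x /a0; elim=> // b y z [].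
move=> da e x0 x0r.
have eps0 : forall x, x \in r -> eps (a x) = 0.
  apply: gen_indep => //.
  have -> : \sum_(x <- r) eps (a x) *: gen x =
      - \sum_(x <- r) gen x * (a x - eps (a x) *: 1).
    apply/eqP; rewrite -addr_eq0 -big_split /=.
    have ex x : eps (a x) *: gen x + gen x * (a x - eps (a x) *: 1) = gen x * a x.
      by rewrite mulrBr -scalerAr mulr1 addrC subrK.
    by rewrite (eq_bigr _ (fun x _ => ex x)) e.
  rewrite -scaleN1r; apply: lspanZ; apply: lspan_sum => x _.
  apply: (Jplus_mul (gen_hprim x)).
  by rewrite /eps coefB coefZ -/(eps 1) eps1 mulr1 subrr.
have /choice[A HA] : forall x, exists T, x \in r -> lspan (@conn_tensor K d.+1) T /\ mu T = a x.
  move=> x; case: (boolP (x \in r)) => [xr|_]; last by exists 0.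
  by have [T HT eT] := mu_surj (eps0 x xr) (da x xr); exists T.
have eA : \sum_(x <- r) tens_mul (tens (gen x) 1) (A x) = 0.
  apply: mu_inj.
    apply: lspan_sum => x /HA[+ _].
    apply: (lspan_map (@tens_mull_linear _ _)) => _ [u [c [Cc _ ->]]].
    rewrite tens_mulE mul1r.
    apply: (lspan_map (@tensl_linear _ _)) (FQSym_spanF (gen x * F u)) => _ [v ->].
    by apply: lspan_gen; exists v, c.
  rewrite (lin_sum (@mu_linear K)) big_seq -[RHS]e [RHS]big_seq.
  by apply: eq_bigr => x /HA[_ <-]; rewrite mu_mull.
have [_ <-] := HA _ x0r.
suff -> : A x0 = 0 by apply: (lin0 (@mu_linear K)).
apply: rslice_eq => p; apply: (IH (fun x => rslice p (A x))) => // [x xr|].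
  have [+ _] := HA x xr; apply: (lspan_map (@rslice_linear _ p)) => _ [u [c [[c0 _] lt ->]]].
  rewrite rslice_tens; apply: lspanZ; apply: lspan_gen; exists u => //; lia.
rewrite -[RHS](lin0 (@rslice_linear K p)) -eA (lin_sum (@rslice_linear _ p)).
by apply: eq_bigr => x _; rewrite rslice_mull.
Qed.

Definition gen_monomial z := exists (x : gen_index) s, z = \prod_(y <- x :: s) gen y.

Lemma gen_monomialM z w : lspan gen_monomial z -> lspan gen_monomial w ->
  lspan gen_monomial (z * w).
Proof.
move=> Hz Hw; apply: (lspan_map (@mulr_linear _ w)) Hz => _ [x [s ->]].
apply: (lspan_map (@mull_linear _ _)) Hw => _ [y [t ->]].
by apply: lspan_gen; exists x, (s ++ y :: t); rewrite -big_cat.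
Qed.

Lemma hmon_deg_gt0 k n z : @hmon K k n z -> (0 < n)%N.
Proof. by case=> [{}n x []|m x {}k {}n y [m0 _ _] _] //; lia. Qed.

(** Modulo the span of the generators, a homogeneous primitive element is a
    sum of products of primitive elements of smaller degrees. *)
Lemma gen_generates n z : hprim n z -> lspan gen_monomial z.
Proof.
have [N] := ubnP n; elim: N n z => // N IH n z nN hz.
have {}IH k m y : @hmon K k m y -> (m < n)%N -> lspan gen_monomial y.
  elim=> [{}m x hx mn|m' x {}k {}m y' hx hy IHy lt].
    by apply: IH hx; lia.
  have := hmon_deg_gt0 hy; have [m0 _ _] := hx => m'0.
  by apply: gen_monomialM; [apply: IH hx; lia | apply: IHy; lia].
have [y [w [Hy hw Jw ->]]] := gen_span hz; apply: lspanD.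
  by apply: lspanS Hy => _ [x ->]; exists x, [::]; rewrite big_seq1.
apply: lspan_sub (Jplus_decomposable hw Jw) => t [k [k1 ht]].
case: ht k1 IH {nN hz hw} => // m x {}k {}n' y' hx hy _ IH.
have := hmon_deg_gt0 hy; have [m0 _ _] := hx => m'0.
apply: gen_monomialM; last by apply: IH hy _; lia.
by apply: (IH 1%N m); [apply: hmon1 | lia].
Qed.

End Generators.

(** * Primitive elements of the subalgebra generated by a Lie algebra *)

Section Filtration.
Variable K : fieldType.
Hypothesis charK0 : [pchar K] =i pred0.
Local Notation H := (FQSym K).
Variable P : H -> Prop.
Hypothesis P_primitive : forall x, P x -> x \in @primitive K.
Hypothesis P_commutator : forall x y, P x -> P y -> P (x * y - y * x).
Implicit Types (x y z : H) (s : seq H).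

Fixpoint splits (T : Type) (s : seq T) : seq (seq T * seq T) :=
  if s is x :: s' then
    [seq (x :: q.1, q.2) | q <- splits s'] ++ [seq (q.1, x :: q.2) | q <- splits s']
  else [:: ([::], [::])].

Lemma size_splits (T : Type) (s : seq T) : size (splits s) = (2 ^ size s)%N.
Proof. by elim: s => //= x s IH; rewrite size_cat !size_map IH expnS mul2n addnn. Qed.

Lemma splits_perm (T : eqType) (s : seq T) q : q \in splits s -> perm_eq (q.1 ++ q.2) s.
Proof.
elim: s q => [|x s IH] q /=; first by rewrite inE => /eqP ->.
rewrite mem_cat => /orP[] /mapP[q' /IH pq ->] /=; first by rewrite perm_cons.
by rewrite perm_catC /= perm_cons perm_catC.
Qed.

Lemma coprod1 : coprod (1 : H) = tens 1 1.
Proof.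
have [r + Hr] := coprodF_lead K empty_perm; rewrite FQSym_oneE => ->.
rewrite big_seq big1 ?addr0 // => q /Hr[q0]; rewrite tag_empty; lia.
Qed.

Lemma coprod_prod s : {in s, forall x, P x} ->
  coprod (\prod_(x <- s) x) =
  \sum_(q <- splits s) tens (\prod_(x <- q.1) x) (\prod_(x <- q.2) x).
Proof.
elim: s => [|x s IH] Ps; first by rewrite /= big_seq1 /= big_nil coprod1.
rewrite big_cons coprodM tens_mul_primitive; last by apply/P_primitive/Ps/mem_head.
rewrite IH => [|y ys]; last by apply: Ps; rewrite inE ys orbT.
rewrite !(lin_sum (@tens_mull_linear _ _)) /= big_cat !big_map /=.
by congr (_ + _); apply: eq_bigr => q _; rewrite tens_mulE mul1r big_cons.
Qed.

(** Products of length 0 are excluded, so that [fil 0] spans 0 and [fil 1] the Lie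
    algebra spanned by P. *)
Definition fil n z := exists s,
  [/\ {in s, forall x, P x}, (0 < size s <= n)%N & z = \prod_(x <- s) x].

Lemma filS m n z : (m <= n)%N -> lspan (fil m) z -> lspan (fil n) z.
Proof.
move=> mn; apply: lspanS => x [s [Ps sm ->]]; exists s; split=> //; lia.
Qed.

Lemma fil_mull n x z : P x -> lspan (fil n.-1) z -> lspan (fil n) (x * z).
Proof.
move=> Px; apply: (lspan_map (@mull_linear _ x)) => _ [s [Ps sn ->]].
apply: lspan_gen; exists (x :: s); rewrite big_cons; split=> //=; last by lia.
by move=> y; rewrite inE => /orP[/eqP ->|/Ps].
Qed.

(** Moving y across an element x of a costs the commutator of x and y, in a
    product with one factor less. *)
Lemma fil_move a y b : {in a ++ b, forall x, P x} -> P y ->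
  lspan (fil (size a + size b))
    (\prod_(x <- a ++ y :: b) x - \prod_(x <- y :: a ++ b) x).
Proof.
move=> + Py; elim: a => [|x a IH] Pab; first by rewrite subrr; apply: lspan0.
have Px : P x by apply: Pab; rewrite mem_head.
have Pab' : {in a ++ b, forall x, P x}.
  by move=> t tab; apply: Pab; rewrite inE tab orbT.
rewrite !cat_cons !big_cons.
have -> : x * \prod_(x <- a ++ y :: b) x - y * (x * \prod_(x <- a ++ b) x) =
  x * (\prod_(x <- a ++ y :: b) x - \prod_(x <- y :: a ++ b) x) +
  (x * y - y * x) * \prod_(x <- a ++ b) x.
  by rewrite big_cons mulrBr mulrBl !mulrA addrA subrK.
apply: lspanD; first by apply: fil_mull => //; apply: IH.
apply: lspan_gen; exists ((x * y - y * x) :: a ++ b); split; last by rewrite big_cons.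
  by move=> t; rewrite inE => /orP[/eqP ->|/Pab' //]; apply: P_commutator.
by rewrite /= size_cat; lia.
Qed.

Lemma fil_splits s q : {in s, forall x, P x} -> q \in splits s ->
  lspan (fil (size s).-1)
    ((\prod_(x <- q.1) x) * (\prod_(x <- q.2) x) - \prod_(x <- s) x).
Proof.
elim: s q => [|x s IH] q Ps /=.
  by rewrite inE => /eqP -> /=; rewrite big_nil mulr1 subrr => *; apply: lspan0.
have Px : P x by apply: Ps; rewrite mem_head.
have Ps' : {in s, forall x, P x} by move=> t ts; apply: Ps; rewrite inE ts orbT.
rewrite mem_cat => /orP[] /mapP[[a b] qs ->] /=; have := IH _ Ps' qs => /= Hab.
  by rewrite !big_cons -mulrA -mulrBr; apply: fil_mull.
have pab := splits_perm qs; rewrite /= in pab.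
have tele (A B C : H) : A - C = (A - B) + (B - C) by rewrite addrA subrK.
rewrite -big_cat (tele _ (\prod_(t <- x :: a ++ b) t)); apply: lspanD.
  rewrite -(perm_size pab) size_cat; apply: fil_move => // t.
  by rewrite (perm_mem pab) => /Ps'.
by rewrite !big_cons big_cat -mulrBr; apply: fil_mull.
Qed.

(** The second Adams operation, the convolution square of the identity. *)
Definition psi z := mu (coprod z).

Lemma psi_linear : linear psi.
Proof. by move=> a x y; rewrite /psi coprod_is_linear mu_linear. Qed.

Lemma psi_primitive x : x \in @primitive K -> psi x = 2%:R *: x.
Proof.
move=> /primitiveE ex; rewrite /psi ex (linD (@mu_linear K)) !mu_tens mulr1 mul1r.
by rewrite scaler_nat mulr2n.
Qed.

(** The coproduct of a product of n primitive elements has 2^n terms, and psi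
    rearranges the factors in each of them. *)
Lemma psi_prod s : {in s, forall x, P x} ->
  lspan (fil (size s).-1)
    (psi (\prod_(x <- s) x) - (2 ^ size s)%N%:R *: \prod_(x <- s) x).
Proof.
move=> Ps; rewrite /psi coprod_prod // (lin_sum (@mu_linear K)).
have sum_cst (r : seq (seq H * seq H)) (z : H) : z *+ size r = \sum_(q <- r) z.
  by rewrite big_const_seq count_predT iter_addr_0.
rewrite scaler_nat -size_splits sum_cst -sumrB.
by apply: lspan_sum => q qs; rewrite mu_tens; apply: fil_splits.
Qed.

(** psi - 2^(n+2) lowers the filtration, while it multiplies the primitive z by
    2 - 2^(n+2), which is invertible in characteristic 0. *)
Lemma primitive_fil_lower n z : z \in @primitive K ->
  lspan (fil n.+2) z -> lspan (fil n.+1) z.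
Proof.
move=> pz Fz.
have : lspan (fil n.+1) (psi z - (2 ^ n.+2)%N%:R *: z).
  apply: (lspan_map (f := fun z => psi z - (2 ^ n.+2)%N%:R *: z)) Fz.
    move=> a x y; rewrite psi_linear !scalerDr !scalerN !scalerA opprD.
    by rewrite addrACA [_ * a]mulrC.
  move=> _ [s [Ps /andP[s0 sn] ->]]; have := psi_prod Ps.
  move: sn; rewrite leq_eqVlt => /orP[/eqP -> //|sn] Hs.
  have tele (A B C : H) : A - C = (A - B) + (B - C) by rewrite addrA subrK.
  rewrite (tele _ ((2 ^ size s)%N%:R *: \prod_(x <- s) x)); apply: lspanD.
    by apply: filS Hs; lia.
  rewrite -scalerBl; apply: lspanZ; apply: lspan_gen; exists s; split=> //.
  by rewrite s0 -ltnS.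
rewrite psi_primitive // -scalerBl => Hz.
have c0 : (2%:R - (2 ^ n.+2)%N%:R : K) != 0.
  rewrite -opprB oppr_eq0 -natrB; last by rewrite expnS leq_pmulr ?expn_gt0.
  by rewrite ((pcharf0P K).1 charK0) subn_eq0 -ltnNge -[X in (X < _)%N]expn1 ltn_exp2l.
by rewrite -[z]scale1r -(mulVf c0) -scalerA; apply: lspanZ.
Qed.

Lemma primitive_fil n z : z \in @primitive K -> lspan (fil n) z -> lspan P z.
Proof.
move=> pz; case: n => [|n].
  by apply: lspan_sub => x [[|y s] [_ + _]].
elim: n => [|n IH]; last by move/(primitive_fil_lower pz)/IH.
apply: lspanS => x [[|y [|t s]] [Ps // _ ->]].
by rewrite big_seq1; apply: Ps; rewrite mem_head.
Qed.

End Filtration.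

(** * Evaluating Lie polynomials in an arbitrary Lie algebra *)

(** Bracketings of letters: the elements of the free magma on X. *)
Inductive magma (X : Type) : Type :=
| Leaf of X
| Node of magma X & magma X.

Fixpoint leaves (X : Type) (t : magma X) : nat :=
  if t is Node l r then (leaves l + leaves r)%N else 1%N.

Lemma leaves_gt0 (X : Type) (t : magma X) : (0 < leaves t)%N.
Proof. by elim: t => //= l IH r _; rewrite addn_gt0 IH. Qed.

Fixpoint lie_eval (K : pzRingType) (g : lieAlgType K) (X : Type) (f : X -> g)
    (t : magma X) : g :=
  match t with
  | Leaf x => f x
  | Node l r => bracket (lie_eval f l) (lie_eval f r)
  end.

Lemma lie_morphism_eval (K : pzRingType) (g h : lieAlgType K) (X : Type)
    (i : X -> g) (f : X -> h) (phi : g -> h) t :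
  lie_morphism phi -> (forall x, phi (i x) = f x) ->
  phi (lie_eval i t) = lie_eval f t.
Proof. by move=> [_ phiM] phif; elim: t => //= l <- r <-. Qed.

Section Words.
Variables (K : fieldType) (X : choiceType).
Local Notation W := {malg K[seq X]}.
Implicit Types (a b w : W) (s : seq X).

Lemma words_span w : lspan (fun z : W => exists s, z = << s >>) w.
Proof.
rewrite [w]monalgE; apply: lspan_sum => s _.
have -> : << w@_s *g s >> = w@_s *: << s >> :> W.
  by apply/malgP => l; rewrite mcoeffZ !mcoeffU mulrnAr mulr1.
by apply: lspanZ; apply: lspan_gen; exists s.
Qed.

(** The concatenation product on words, which makes W the free associative
    algebra on X. *)
Definition wmul a b : W := lext2 (fun s t => << s ++ t >>) a b.

Lemma wmull_linear b : linear (fun a => wmul a b).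
Proof. by move=> c a a'; apply: lext2Pl. Qed.

Lemma wmulr_linear a : linear (wmul a).
Proof. by move=> c b b'; apply: lext2Pr. Qed.

Lemma wmulU s t : wmul << s >> << t >> = << s ++ t >>.
Proof. exact: lext2U. Qed.

Fixpoint word_eval (t : magma X) : W :=
  match t with
  | Leaf x => << [:: x] >>
  | Node l r => wmul (word_eval l) (word_eval r) - wmul (word_eval r) (word_eval l)
  end.

Lemma word_eval_homog t :
  lspan (fun z : W => exists2 s, size s = leaves t & z = << s >>) (word_eval t).
Proof.
elim: t => [x|l IHl r IHr] /=; first by apply: lspan_gen; exists [:: x].
have main m n (a b : W) : lspan (fun z : W => exists2 s, size s = m & z = << s >>) a ->
    lspan (fun z : W => exists2 s, size s = n & z = << s >>) b ->
    lspan (fun z : W => exists2 s, size s = (m + n)%N & z = << s >>) (wmul a b).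
  move=> Ha Hb; apply: (lspan_map (wmull_linear b)) Ha => _ [s ss ->].
  apply: (lspan_map (wmulr_linear _)) Hb => _ [t st ->].
  by apply: lspan_gen; exists (s ++ t); rewrite ?wmulU // size_cat ss st.
by apply: lspanB; [|rewrite addnC]; apply: main.
Qed.

Section Target.
Variables (h : lieAlgType K) (f : X -> h).
Implicit Types y z : h.

Lemma bracketl_linear z : linear (fun y => bracket y z).
Proof. by move=> c y y'; apply: bracketPl. Qed.

Lemma bracketr_linear z : linear (bracket z : h -> h).
Proof. by move=> c y y'; apply: bracketPr. Qed.

Lemma bracketC y z : bracket y z = - bracket z y.
Proof.
have := bracketxx (y + z); rewrite (linD (bracketl_linear _)).
rewrite !(linD (bracketr_linear _)) !bracketxx add0r addr0.
by move/eqP; rewrite addr_eq0 => /eqP.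
Qed.

Lemma bracket_adjoint x y z :
  bracket (bracket x y) z = bracket x (bracket y z) - bracket y (bracket x z).
Proof.
have := jacobi x y z; rewrite [bracket z x]bracketC [bracket z (bracket x y)]bracketC.
rewrite -scaleN1r (linZ (bracketr_linear _)) scaleN1r.
by move/eqP; rewrite subr_eq0 => /eqP.
Qed.

Definition adword s y : h := foldr (fun x y => bracket (f x) y) y s.

Lemma adword_linear s : linear (adword s).
Proof.
by elim: s => //= x s IH c y z; rewrite /adword /= -!/(adword s _) IH bracketr_linear.
Qed.

(** The action on h of the free associative algebra in which a letter x acts by
    the bracket with f x. *)
Definition ad w y : h := lext (fun s => adword s y) w.

Lemma ad_linear y : linear (fun w => ad w y).
Proof. by move=> c w w'; apply: lext_is_linear. Qed.

Lemma ad_wmul a b y : ad (wmul a b) y = ad a (ad b y).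
Proof.
apply: (lspan_eq (f := fun a => ad (wmul a b) y) (g := fun a => ad a (ad b y)))
  (words_span a).
- by move=> c a1 a2; rewrite wmull_linear ad_linear.
- exact: ad_linear.
move=> _ [s ->].
apply: (lspan_eq (f := fun b => ad (wmul << s >> b) y) (g := fun b => ad << s >> (ad b y)))
  (words_span b).
- by move=> c b1 b2; rewrite wmulr_linear ad_linear.
- by move=> c b1 b2; rewrite ad_linear /ad [LHS]lextU adword_linear !lextU.
by move=> _ [t ->]; rewrite wmulU /ad !lextU /adword foldr_cat.
Qed.

(** Lie polynomials act by inner derivations, by the Jacobi identity. *)
Lemma ad_word_eval t y : ad (word_eval t) y = bracket (lie_eval f t) y.
Proof.
elim: t y => [x|l IHl r IHr] y /=; first by rewrite /ad lextU.
by rewrite (linB (ad_linear _)) !ad_wmul !IHl !IHr bracket_adjoint.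
Qed.

Fixpoint right_bracket s : h :=
  match s with
  | [::] => 0
  | [:: x] => f x
  | x :: s' => bracket (f x) (right_bracket s')
  end.

Lemma right_bracket_cat s t : (0 < size t)%N ->
  right_bracket (s ++ t) = adword s (right_bracket t).
Proof.
move=> t0; elim: s => //= x s <-.
by case: s => [|//] /=; case: t t0.
Qed.

(** The Dynkin operator with values in h. *)
Definition dynkin w : h := lext right_bracket w.

Lemma dynkin_linear : linear dynkin. Proof. exact: lext_is_linear. Qed.

Lemma dynkin_wmul n a b : (0 < n)%N ->
  lspan (fun z : W => exists2 s, size s = n & z = << s >>) b ->
  dynkin (wmul a b) = ad a (dynkin b).
Proof.
move=> n0; apply: (lspan_eq (f := fun b => dynkin (wmul a b)) (g := fun b => ad a (dynkin b))).
- by move=> c b1 b2; rewrite wmulr_linear dynkin_linear.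
- move=> c b1 b2; rewrite dynkin_linear /ad !lextE scaler_sumr -big_split /=.
  by apply: eq_bigr => s _; rewrite adword_linear scalerDr !scalerA mulrC.
move=> _ [t st ->].
apply: (lspan_eq (f := fun a => dynkin (wmul a << t >>)) (g := fun a => ad a (dynkin << t >>)))
  (words_span a).
- by move=> c b1 b2; rewrite wmull_linear dynkin_linear.
- exact: ad_linear.
move=> _ [s ->]; rewrite wmulU /dynkin !lextU /ad lextU right_bracket_cat //.
by rewrite st.
Qed.

(** Dynkin, Specht and Wever: by [dynkin_wmul] and [ad_word_eval], the value on a
    commutator is a sum of two brackets, one for each factor, in which the value
    on that factor counts its leaves. *)
Lemma dynkin_word_eval t : dynkin (word_eval t) = (leaves t)%:R *: lie_eval f t.
Proof.
elim: t => [x|l IHl r IHr] /=; first by rewrite /dynkin lextU scale1r.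
rewrite (linB dynkin_linear).
rewrite (dynkin_wmul _ (leaves_gt0 r) (word_eval_homog r)).
rewrite (dynkin_wmul _ (leaves_gt0 l) (word_eval_homog l)).
rewrite !ad_word_eval IHl IHr !(linZ (bracketr_linear _)).
rewrite [bracket (lie_eval f r) _]bracketC scalerN opprK -scalerDl -natrD.
by rewrite addnC.
Qed.

Definition dynkin_div w : h := lext (fun s => (size s)%:R^-1 *: right_bracket s) w.

Lemma dynkin_div_linear : linear dynkin_div. Proof. exact: lext_is_linear. Qed.

Lemma dynkin_div_word_eval t : [pchar K] =i pred0 ->
  dynkin_div (word_eval t) = lie_eval f t.
Proof.
move=> charK0.
have -> : dynkin_div (word_eval t) = (leaves t)%:R^-1 *: dynkin (word_eval t).
  apply: (lspan_eq (f := dynkin_div) (g := fun w => (leaves t)%:R^-1 *: dynkin w))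
    (word_eval_homog t).
  - exact: dynkin_div_linear.
  - by move=> c a b; rewrite dynkin_linear scalerDr !scalerA mulrC.
  by move=> _ [s st ->]; rewrite /dynkin_div /dynkin !lextU st.
rewrite dynkin_word_eval scalerA mulVf ?scale1r //.
by rewrite ((pcharf0P K).1 charK0) -lt0n leaves_gt0.
Qed.

Lemma dynkin_div_bracket a b : [pchar K] =i pred0 ->
  lspan (fun z : W => exists t, z = word_eval t) a ->
  lspan (fun z : W => exists t, z = word_eval t) b ->
  dynkin_div (wmul a b - wmul b a) = bracket (dynkin_div a) (dynkin_div b).
Proof.
move=> charK0 Ha Hb.
apply: (lspan_eq (f := fun a => dynkin_div (wmul a b - wmul b a))
  (g := fun a => bracket (dynkin_div a) (dynkin_div b))) Ha.
- move=> c a1 a2; rewrite wmull_linear wmulr_linear -dynkin_div_linear.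
  by rewrite scalerBr opprD addrACA.
- by move=> c a1 a2; rewrite dynkin_div_linear bracketl_linear.
move=> _ [t ->].
apply: (lspan_eq (f := fun b => dynkin_div (wmul (word_eval t) b - wmul b (word_eval t)))
  (g := fun b => bracket (dynkin_div (word_eval t)) (dynkin_div b))) Hb.
- move=> c a1 a2; rewrite wmull_linear wmulr_linear -dynkin_div_linear.
  by rewrite scalerBr opprD addrACA.
- by move=> c a1 a2; rewrite dynkin_div_linear bracketr_linear.
move=> _ [t' ->]; rewrite -/(word_eval (Node t t')) !dynkin_div_word_eval //.
Qed.

End Target.

Definition strip x w : W :=
  lext (fun s => if s is y :: s' then (y == x)%:R *: << s' >> else 0) w.

Lemma strip_linear x : linear (strip x). Proof. exact: lext_is_linear. Qed.

Lemma strip_sum w : exists2 r : seq X, uniq r &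
  w = w@_[::] *: << [::] >> + \sum_(x <- r) wmul << [:: x] >> (strip x w).
Proof.
have [r Ur Hr] : exists2 r : seq X, uniq r &
    lspan (fun z : W => exists2 s, (forall x s', s = x :: s' -> x \in r) & z = << s >>) w.
  elim: (words_span w) => [|c _ z [s ->] _ [r Ur IH]].
    by exists [::]; last by apply: lspan0.
  exists (undup ((if s is x :: _ then [:: x] else [::]) ++ r)); first exact: undup_uniq.
  apply: lspan_cons; last first.
    apply: lspanS IH => _ [s' Hs' ->]; exists s' => // x t /Hs' xr.
    by rewrite mem_undup mem_cat xr orbT.
  by exists s => // x t ->; rewrite mem_undup mem_head.
exists r => //.
apply: (lspan_eq (f := id) (g := fun w : W =>
  w@_[::] *: << [::] >> + \sum_(x <- r) wmul << [:: x] >> (strip x w))) Hr => //.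
  move=> c a b; rewrite mcoeffD mcoeffZ scalerDl scalerDr scalerA addrACA.
  rewrite scaler_sumr; congr (_ + _); rewrite -big_split; apply: eq_bigr => x _ /=.
  by rewrite strip_linear wmulr_linear.
move=> _ [[|x s] Hs ->].
  rewrite mcoeffUU scale1r big1 ?addr0 // => x _.
  by rewrite /strip lextU (lin0 (wmulr_linear _)).
have xr := Hs _ _ erefl.
rewrite mcoeffU /= scale0r add0r (bigD1_seq x) //= /strip lextU eqxx scale1r wmulU.
rewrite big1 ?addr0 // => y nyx.
by rewrite lextU eq_sym (negbTE nyx) scale0r (lin0 (wmulr_linear _)).
Qed.

Lemma strip_size x d w :
  lspan (fun z : W => exists2 s, (size s < d.+1)%N & z = << s >>) w ->
  lspan (fun z : W => exists2 s, (size s < d)%N & z = << s >>) (strip x w).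
Proof.
apply: (lspan_map (@strip_linear x)) => _ [[|y s] sd ->]; rewrite /strip lextU.
  exact: lspan0.
by apply: lspanZ; apply: lspan_gen; exists s.
Qed.

End Words.

(** * The universal property *)

Section FreeLie.
Variable K : fieldType.
Hypothesis charK0 : [pchar K] =i pred0.
Local Notation H := (FQSym K).
Local Notation X := (gen_index K).
Local Notation W := {malg K[seq X]}.

Definition prod_eval (w : W) : H := lext (fun s => \prod_(x <- s) gen x) w.

Lemma prod_eval_linear : linear prod_eval. Proof. exact: lext_is_linear. Qed.

Lemma prod_evalM a b : prod_eval (wmul a b) = prod_eval a * prod_eval b.
Proof.
apply: (lspan_eq (f := fun a => prod_eval (wmul a b)) (g := fun a => prod_eval a * prod_eval b))
  (words_span a).
- by move=> c a1 a2; rewrite wmull_linear prod_eval_linear.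
- by move=> c a1 a2; rewrite prod_eval_linear mulr_linear.
move=> _ [s ->].
apply: (lspan_eq (f := fun b => prod_eval (wmul << s >> b))
  (g := fun b => prod_eval << s >> * prod_eval b)) (words_span b).
- by move=> c a1 a2; rewrite wmulr_linear prod_eval_linear.
- by move=> c a1 a2; rewrite prod_eval_linear mull_linear.
by move=> _ [t ->]; rewrite wmulU /prod_eval !lextU big_cat.
Qed.

(** Splitting off first letters writes prod_eval w as a constant plus a right
    combination of the generators; the counit kills the constant, and
    [gen_right_indep] the coefficients. *)
Lemma prod_eval_inj w : prod_eval w = 0 -> w = 0.
Proof.
have [d] : exists d, lspan (fun z : W => exists2 s, (size s < d)%N & z = << s >>) w.
  elim: (words_span w) => [|c _ z [s ->] _ [d IH]]; first by exists 0%N; apply: lspan0.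
  exists (maxn (size s).+1 d); apply: lspan_cons; first by exists s => //; lia.
  by apply: lspanS IH => _ [t td ->]; exists t => //; lia.
elim: d w => [|d IH] w dw; first by move=> _; elim: dw => // c y z [].
have [r Ur ew] := strip_sum w.
have eE : prod_eval w = w@_[::] *: 1 + \sum_(x <- r) gen x * prod_eval (strip x w).
  rewrite {1}ew (linD prod_eval_linear) (linZ prod_eval_linear) (lin_sum prod_eval_linear).
  congr (_ *: _ + _); first by rewrite /prod_eval lextU big_nil.
  by apply: eq_bigr => x _; rewrite prod_evalM /prod_eval lextU big_seq1.
rewrite eE => e0.
have w0 : w@_[::] = 0.
  have := congr1 (@eps K) e0; rewrite /eps coefD coefZ coef_sum coef0 -/(eps 1) eps1 mulr1.
  rewrite big1 ?addr0 // => x _.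
  by rewrite -/(eps _) epsM eps_primitive ?mul0r //; apply: gen_primitive.
move: e0; rewrite w0 scale0r add0r => /(gen_right_indep Ur) s0.
rewrite ew w0 scale0r add0r big_seq big1 // => x xr.
by rewrite (IH _ (strip_size x dw) (s0 x xr)) (lin0 (@wmulr_linear K _ _)).
Qed.

Definition prim_gen (x : X) : Prim K := MkPrim (gen_primitive x).

Lemma prod_eval_word_eval t :
  prod_eval (word_eval K t) = prim_val (lie_eval prim_gen t).
Proof.
elim: t => [x|l IHl r IHr] /=; first by rewrite /prod_eval lextU big_seq1.
by rewrite (linB prod_eval_linear) !prod_evalM IHl IHr.
Qed.

(** The generators generate primitive elements associatively by
    [gen_generates], hence as a Lie algebra by [primitive_fil]. *)
Lemma prim_generated (y : Prim K) : lspan (fun z => exists t, z = lie_eval prim_gen t) y.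
Proof.
pose P (z : H) := exists t, z = prim_val (lie_eval prim_gen t).
have Pprim z : P z -> z \in @primitive K by move=> [t ->]; apply: valP.
have Pcomm z w : P z -> P w -> P (z * w - w * z).
  by move=> [t ->] [t' ->]; exists (Node t t').
have [n Hn] : exists n, lspan (fil P n) (val y).
  have : lspan (@gen_monomial K) (val y).
    apply: lspan_sub (hprim_span (valP y)) => z [n]; exact: gen_generates.
  elim=> [|c _ z [x [s ->]] _ [n IH]]; first by exists 0%N; apply: lspan0.
  exists (maxn (size s).+1 n); apply: lspan_cons; last by apply: filS IH; lia.
  exists (map (@gen K) (x :: s)); rewrite big_map; split=> //.
    by move=> _ /mapP[x' _ ->]; exists (Leaf x').
  by rewrite size_map /=; lia.
have Py := primitive_fil charK0 Pprim Pcomm (valP y) Hn.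
suff [y' Hy' ey] : exists2 y' : Prim K,
    lspan (fun z => exists t, z = lie_eval prim_gen t) y' & val y' = val y.
  by rewrite -(val_inj ey).
elim: Py => [|c _ w [t ->] _ [y' Hy' <-]]; first by exists 0; first by apply: lspan0.
by exists (c *: lie_eval prim_gen t + y') => //; apply: lspan_cons => //; exists t.
Qed.

Theorem Prim_free : free_lie_on prim_gen.
Proof.
move=> h f; split; last first.
  move=> phi psi Lphi Lpsi ephi epsi y.
  apply: (lspan_eq Lphi.1 Lpsi.1) (prim_generated y) => _ [t ->].
  by rewrite (lie_morphism_eval _ Lphi ephi) (lie_morphism_eval _ Lpsi epsi).
(* the Lie polynomial of a primitive element in the generators *)
have /choice[rho Hrho] : forall y : Prim K, exists w : W,
    lspan (fun z => exists t, z = word_eval K t) w /\ prod_eval w = prim_val y.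
  move=> y; elim: (prim_generated y) => [|c _ z [t ->] _ [w [Hw ew]]].
    by exists 0; split; [apply: lspan0 | apply: (lin0 prod_eval_linear)].
  exists (c *: word_eval K t + w); split.
    by apply: lspan_cons => //; exists t.
  by rewrite prod_eval_linear prod_eval_word_eval ew.
have rhoE y w : prod_eval w = prim_val y -> rho y = w.
  move=> ew; apply/eqP; rewrite -subr_eq0; apply/eqP/prod_eval_inj.
  by rewrite (linB prod_eval_linear) (Hrho y).2 ew subrr.
exists (fun y => dynkin_div f (rho y)); split; [split|].
- move=> c y z; rewrite -dynkin_div_linear; congr dynkin_div; apply: rhoE.
  by rewrite prod_eval_linear !(Hrho _).2.
- move=> y z; rewrite -(dynkin_div_bracket f charK0 (Hrho y).1 (Hrho z).1).
  congr dynkin_div; apply: rhoE.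
  by rewrite (linB prod_eval_linear) !prod_evalM !(Hrho _).2.
move=> x; rewrite (@rhoE _ (word_eval K (Leaf x))) ?dynkin_div_word_eval //.
exact: prod_eval_word_eval.
Qed.

End FreeLie.

Theorem corollary40 (K : fieldType) (charK0 : [pchar K] =i pred0) :
  is_free_lie (Prim K).
Proof. by exists (gen_index K), (@prim_gen K); apply: Prim_free. Qed.
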